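(* Let $n\geq 1$ and let $R$ be an $n$-Gorenstein artin algebra. Then $R_i(\mathrm{mod}\, R)=\Omega_i(\mathrm{mod}\, R)$ for every $1\leq i\leq n$.
   Context: $\mathrm{mod}\,R$ is the category of finitely generated left $R$-modules. For a module $M$, $0\to M\to I_0(M)\to I_1(M)\to\cdots$ denotes its minimal injective resolution; $I_j(R)$ (resp. $I_j(R^{op})$) refers to $R$ as a left (resp. right) $R$-module; $\mathrm{fd}$ is flat dimension. $R$ is $n$-Gorenstein if $\mathrm{fd}\,I_i(R^{op})\leq i$ for every $0\leq i\leq n-1$ (this condition is left-right symmetric). For $i\geq 1$: $R_i(\mathrm{mod}\,R)$ is the class of $M\in\mathrm{mod}\,R$ such that for every $0\leq l\leq i-1$, $I_l(M)$ is isomorphic to a direct summand of a direct sum of copies of $\bigoplus_{j\leq l}I_j(R)$. $\Omega_i(\mathrm{mod}\,R)$ is the class of $i$-syzygy modules, i.e. $M\in\mathrm{mod}\,R$ for which there is an exact sequence $0\to M\to P_{i-1}\to\cdots\to P_0\to A\to 0$ in $\mathrm{mod}\,R$ with every $P_j$ projective. *)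

(* Defs.v *)
From HB Require Import structures.
From mathcomp Require Import all_boot all_algebra.

Set Implicit Arguments.
Unset Strict Implicit.
Unset Printing Implicit Defensive.

Import GRing.Theory.
Local Open Scope ring_scope.

(* Left S-modules are [lmodType S]; right S-modules are left modules over the
   converse ring, [lmodType S^c].  The ring S is the left module [S^o] and the
   right module [(S^c)^o]. *)

Definition surj (A B : Type) (f : A -> B) : Prop := forall y, exists x, f x = y.

Definition exact (U : Type) (V W : nmodType) (f : U -> V) (g : V -> W) : Prop :=
  forall y, g y = 0 <-> exists x, f x = y.

Definition is_submodule (S : pzRingType) (M : lmodType S) (N : M -> Prop) : Prop :=
  [/\ N 0, forall x y, N x -> N y -> N (x + y)
    & forall (r : S) x, N x -> N (r *: x)].

Definition fingen (S : pzRingType) (M : lmodType S) : Prop :=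
  exists (n : nat) (v : 'I_n -> M),
    forall x, exists c : 'I_n -> S, x = \sum_(i < n) c i *: v i.

Definition artinian (k : comNzRingType) : Prop :=
  forall J : nat -> k^o -> Prop,
    (forall n, is_submodule (J n)) ->
    (forall n x, J n.+1 x -> J n x) ->
    exists n, forall m, (n <= m)%N -> forall x, J m x <-> J n x.

Definition artin_algebra (k : comNzRingType) (R : algType k) : Prop :=
  artinian k /\ fingen (R : lmodType k).

Definition projective (S : pzRingType) (P : lmodType S) : Prop :=
  forall (A B : lmodType S) (p : {linear A -> B}) (g : {linear P -> B}),
    surj p -> exists h : {linear P -> A}, forall x, p (h x) = g x.

Definition injective_module (S : pzRingType) (E : lmodType S) : Prop :=
  forall (A B : lmodType S) (i : {linear A -> B}) (g : {linear A -> E}),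
    injective i -> exists h : {linear B -> E}, forall x, h (i x) = g x.

Definition essential_image (S : pzRingType) (U V : lmodType S)
    (f : {linear U -> V}) : Prop :=
  forall N : V -> Prop, is_submodule N -> (exists2 y, N y & y <> 0) ->
    exists2 x, N (f x) & f x <> 0.

(* 0 -> M -> I_0 -> I_1 -> ...; minimality says that I_0 is an injective
   envelope of M and I_(j+1) one of the cokernel of the map into I_j. *)
Record min_inj_res (S : pzRingType) (M : lmodType S) := MinInjRes {
  mir_term :> nat -> lmodType S;
  mir_aug : {linear M -> mir_term 0%N};
  mir_diff : forall j, {linear mir_term j -> mir_term j.+1};
  mir_injective : forall j, injective_module (mir_term j);
  mir_aug_inj : injective mir_aug;
  mir_exact0 : exact mir_aug (mir_diff 0);
  mir_exact : forall j, exact (mir_diff j) (mir_diff j.+1);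
  mir_essential0 : essential_image mir_aug;
  mir_essential : forall j, essential_image (mir_diff j) }.

Definition balanced (S : pzRingType) (F : lmodType S^c) (A : lmodType S)
    (G : zmodType) (b : F -> A -> G) : Prop :=
  [/\ forall x y a, b (x + y) a = b x a + b y a,
      forall x a a', b x (a + a') = b x a + b x a'
    & forall x (r : S) a, b ((r : S^c) *: x) a = b x (r *: a)].

(* (T, t) is the tensor product of F and A over S. *)
Definition is_tensor (S : pzRingType) (F : lmodType S^c) (A : lmodType S)
    (T : zmodType) (t : F -> A -> T) : Prop :=
  balanced t /\
  forall (G : zmodType) (b : F -> A -> G), balanced b ->
    exists h : {additive T -> G}, (forall x a, h (t x a) = b x a) /\
      forall h' : {additive T -> G}, (forall x a, h' (t x a) = b x a) -> h' =1 h.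

(* A right module F is flat when tensoring with F preserves injections; h below
   is the map induced by f on the tensor products. *)
Definition flat (S : pzRingType) (F : lmodType S^c) : Prop :=
  forall (A B : lmodType S) (f : {linear A -> B}), injective f ->
  forall (TA TB : zmodType) (tA : F -> A -> TA) (tB : F -> B -> TB),
    is_tensor tA -> is_tensor tB ->
  forall h : {additive TA -> TB}, (forall x a, h (tA x a) = tB x (f a)) ->
    injective h.

(* fd M <= d, for a right module M: the terms F_j with j > d are zero. *)
Definition fd_le (S : pzRingType) (M : lmodType S^c) (d : nat) : Prop :=
  exists (F : nat -> lmodType S^c) (e : {linear F 0%N -> M})
         (p : forall j, {linear F j.+1 -> F j}),
    [/\ forall j, flat (F j),
        surj e,
        exact (p 0%N) e,
        forall j, exact (p j.+1) (p j)
      & forall j, (d < j)%N -> forall x : F j, x = 0].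

(* Minimal injective resolutions exist and are unique up to isomorphism, so here
   and in [R_class] it does not matter which ones are taken. *)
Definition n_Gorenstein (n : nat) (S : pzRingType) : Prop :=
  exists I : min_inj_res (S^c)^o, forall i, (i < n)%N -> fd_le (I i) i.

Definition is_direct_sum (S : pzRingType) (X : Type) (W : X -> lmodType S)
    (D : lmodType S) (inj : forall i, {linear W i -> D}) : Prop :=
  forall (N : lmodType S) (g : forall i, {linear W i -> N}),
    exists h : {linear D -> N}, (forall i x, h (inj i x) = g i x) /\
      forall h' : {linear D -> N}, (forall i x, h' (inj i x) = g i x) -> h' =1 h.

Definition iso_direct_summand (S : pzRingType) (U D : lmodType S) : Prop :=
  exists (V : lmodType S) (f : {linear (U * V)%type -> D}), bijective f.

(* U is isomorphic to a direct summand of a direct sum of copies of W (over an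
   arbitrary index set X). *)
Definition in_Add (S : pzRingType) (W U : lmodType S) : Prop :=
  exists (X : Type) (D : lmodType S) (inj : X -> {linear W -> D}),
    is_direct_sum inj /\ iso_direct_summand U D.

Definition R_class (S : pzRingType) (i : nat) (M : lmodType S) : Prop :=
  fingen M /\
  exists (IM : min_inj_res M) (IS : min_inj_res S^o),
    forall l, (l < i)%N ->
      exists (W : lmodType S) (inj : forall j : 'I_l.+1, {linear IS j -> W}),
        is_direct_sum inj /\ in_Add W (IM l).

(* The sequence 0 -> M -> P_(i-1) -> ... -> P_0 -> A -> 0 is reindexed from the
   left: P_(i-1-j) is C j for j < i, and A is C i.  Meant for i >= 1; the terms
   C j and the maps d j beyond A play no role. *)
Definition Omega_class (S : pzRingType) (i : nat) (M : lmodType S) : Prop :=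
  fingen M /\
  exists (C : nat -> lmodType S) (e : {linear M -> C 0%N})
         (d : forall j, {linear C j -> C j.+1}),
    [/\ forall j, (j <= i)%N -> fingen (C j),
        forall j, (j < i)%N -> projective (C j),
        injective e /\ exact e (d 0%N),
        forall j, (j.+1 < i)%N -> exact (d j) (d j.+1)
      & forall j, j.+1 = i -> surj (d j)].

(* Main.v *)
Require Import Defs.
From HB Require Import structures.
From mathcomp Require Import all_boot all_algebra.
From mathcomp Require Import boolp classical_sets.

Set Implicit Arguments.
Unset Strict Implicit.
Unset Printing Implicit Defensive.

Import GRing.Theory.
Local Open Scope ring_scope.

(** An [i]-syzygy [M] sits in short exact sequences [0 -> M -> P -> N -> 0] with [N]
    an [(i-1)]-syzygy, and the horseshoe lemma applied to the cokernel of
    [M -> P -> I_0(P)] produces an injective resolution of [M] with terms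
    [I_(l+1)(P) + I_l(N)].  Every term of a minimal resolution is a direct summand of
    the corresponding term of any other ([inj_term_retract]), so by induction
    [I_l(M)] is a summand of a finite sum of copies of [I_0(R), ..., I_l(R)]
    ([syzygy_R_class]).  Minimal injective resolutions are provided by
    [min_inj_res_exists].

    Conversely let [M] belong to [R_i].  Since [R] is noetherian on both sides, [M]
    has a left approximation [M -> P^0] by a free module of finite rank, through which
    all maps from [M] to free modules factor; its cokernel [M_1] has an approximation
    [M_1 -> P^1], and so on.  The point is that the first [i] of these approximations
    are injective; then [M -> P^0 -> ... -> P^(i-1)] exhibits [M] as an [i]-syzygy.

    Suppose that this is known before [M_j], with [j < i].  Then [Ext^s(M_j, R) = 0]
    for [1 <= s <= j], by the approximation property.  Let [N] be a cyclic submodule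
    of the kernel of [M_j -> P^j]; all functionals on [M_j] vanish on [N].

    - Let [I_t] be the terms of the minimal injective resolution of [R] as a right
      module, and [t <= s <= j].  As [fd I_t <= t], the group [Tor_(s+1)(I_t, M_j/N)]
      vanishes, so [Tor_s(I_t, N)] embeds in [Tor_s(I_t, M_j)].  By duality with
      [Ext^s(-, R)] this embedding is zero, hence [Tor_s(I_t, N) = 0] ([tor_zero]),
      that is, [Hom(Ext^s(N, R), I_t) = 0] for all [t <= s].
    - By induction on [s <= j] this forces [Ext^s(N, R) = 0]: if the lower groups
      vanish, then [Ext^s(N, R)] embeds in a module with a free resolution of length
      [s] dual to the one of [N], and a module [Y] with [Ext^t(Y, R) = 0] for all
      [t <= s] has no map to such a module ([ext_zero_of_tor_zero]).
    - Since this applies to all cyclic submodules of the kernel, minimality of the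
      injective resolution of the left module [R] gives [Hom(N, I_s(R)) = 0] for
      [s <= j] ([hom_zero_of_ext]).  As [M] belongs to [R_i], also
      [Hom(N, I_s(M)) = 0], so [Ext^j(N, M) = 0].
    - Dimension shifting along [M -> P^0 -> ... -> M_j] turns this into
      [Hom(N, M_j) = 0], so [N = 0] ([approximation_exact]).

    Finitely generated free modules are treated through matrices: a free resolution
    is a sequence of matrices, and Ext and Tor vanish when certain matrices act
    exactly on tuples of module elements. *)

(** * Submodules, quotients and products *)

Section LinearOf.
Variables (S : pzRingType) (U V : lmodType S) (f : U -> V) (hf : linear f).
Definition linear_of (_ : linear f) := f.
HB.instance Definition _ :=
  GRing.isLinear.Build S U V *:%R (linear_of hf) hf.
Lemma linear_ex : exists g : {linear U -> V}, g =1 f.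
Proof. by exists (linear_of hf). Qed.
End LinearOf.

Section Submodules.
Variables (S : pzRingType) (L : lmodType S) (N : L -> Prop).
Hypothesis hN : is_submodule N.

Lemma submod0 : N 0. Proof. by case: hN. Qed.
Lemma submodD x y : N x -> N y -> N (x + y). Proof. by case: hN => _ + _; exact. Qed.
Lemma submodZ r x : N x -> N (r *: x). Proof. by case: hN => _ _; exact. Qed.
Lemma submodN x : N x -> N (- x). Proof. by move=> /(submodZ (-1)); rewrite scaleN1r. Qed.
Lemma submodB x y : N x -> N y -> N (x - y).
Proof. by move=> hx /submodN; exact: submodD. Qed.
Lemma submod_sum (I : Type) (r : seq I) (P : pred I) (F : I -> L) :
  (forall i, P i -> N (F i)) -> N (\sum_(i <- r | P i) F i).
Proof. by move=> h; elim/big_rec: _ => [|i x Pi]; [exact: submod0|exact/submodD/h]. Qed.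
Lemma submodDl x y : N x -> N (x + y) <-> N y.
Proof. by move=> hx; split=> [/(submodD (submodN hx))|]; rewrite ?addKr //; exact: submodD. Qed.
End Submodules.

Section ImageKernel.
Variables (S : pzRingType) (U V : lmodType S) (f : {linear U -> V}).
Lemma submod_zero : is_submodule (fun x : U => x = 0).
Proof.
by split=> [//|x y -> ->|r x ->]; rewrite ?addr0 ?scaler0.
Qed.
Lemma submod_ker : is_submodule (fun x => f x = 0).
Proof.
split=> [|x y hx hy|r x hx]; first exact: linear0.
  by rewrite linearD hx hy addr0.
by rewrite linearZ /= hx scaler0.
Qed.
Lemma submod_im (N : U -> Prop) : is_submodule N ->
  is_submodule (fun y => exists2 x, N x & y = f x).
Proof.
move=> hN; split.
- by exists 0; [exact: submod0 hN|rewrite linear0].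
- move=> _ _ [x hx ->] [y hy ->].
  by exists (x + y); [exact: submodD hN _ _ hx hy|rewrite linearD].
- by move=> r _ [x hx ->]; exists (r *: x); [exact: submodZ|rewrite linearZ].
Qed.
Lemma submod_range : is_submodule (fun y => exists x, f x = y).
Proof.
split; first by exists 0; rewrite linear0.
- by move=> _ _ [x <-] [y <-]; exists (x + y); rewrite linearD.
- by move=> r _ [x <-]; exists (r *: x); rewrite linearZ.
Qed.
Lemma submod_preim (N : V -> Prop) : is_submodule N -> is_submodule (fun x => N (f x)).
Proof.
move=> hN; split; first by rewrite linear0; exact: submod0 hN.
- by move=> x y; rewrite linearD; exact: submodD.
- by move=> r x; rewrite linearZ; exact: submodZ.
Qed.
Lemma lin_inj : (forall x, f x = 0 -> x = 0) -> injective f.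
Proof. by move=> h x y /eqP; rewrite -subr_eq0 -linearB => /eqP/h/eqP; rewrite subr_eq0 => /eqP. Qed.
Lemma inj_lin0 : injective f -> forall x, f x = 0 -> x = 0.
Proof. by move=> fi x; rewrite -(linear0 f) => /fi. Qed.
End ImageKernel.

Lemma submod_span1 (S : pzRingType) (L : lmodType S) (x : L) :
  is_submodule (fun y => exists r, y = r *: x).
Proof.
split; first by exists 0; rewrite scale0r.
- by move=> _ _ [r ->] [s ->]; exists (r + s); rewrite scalerDl.
- by move=> r _ [s ->]; exists (r * s); rewrite scalerA.
Qed.

Section Quotient.
Variables (S : pzRingType) (L : lmodType S) (N : L -> Prop) (hN : is_submodule N).

(** Canonical representatives make the quotient a subtype of [L], so that equality of
    cosets is Leibniz equality. *)
Definition coset_rep (x : L) : L := choose (fun y => `[< N (x - y) >]) x.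

Lemma coset_repP x : N (x - coset_rep x).
Proof.
apply/asboolP; apply: (@chooseP _ (fun y => `[< N (x - y) >]) x).
by apply/asboolP; rewrite subrr; exact: submod0.
Qed.

Lemma coset_rep_eq x y : N (x - y) -> coset_rep x = coset_rep y.
Proof.
move=> h; rewrite /coset_rep.
have E : (fun z => `[< N (x - z) >]) =1 (fun z => `[< N (y - z) >]).
  move=> z; apply/asbool_equiv_eq.
  by rewrite -(@submodDl _ _ _ hN (x - y) (y - z)) // addrA subrK.
rewrite (eq_choose E) (@choose_id _ _ x y) //.
  by rewrite -E; apply/asboolP; rewrite subrr; exact: submod0.
by apply/asboolP; rewrite subrr; exact: submod0.
Qed.

Lemma coset_repK x : coset_rep (coset_rep x) = coset_rep x.
Proof. by apply/esym/coset_rep_eq/coset_repP. Qed.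

Definition quot (_ : is_submodule N) : Type := {x : L | coset_rep x == x}.
Local Notation Q := (quot hN).
HB.instance Definition _ := Choice.on Q.

Definition to_quot (x : L) : Q := exist _ (coset_rep x) (introT eqP (coset_repK x)).

Lemma to_quot_eq x y : N (x - y) -> to_quot x = to_quot y.
Proof. by move=> h; apply: val_inj; exact: coset_rep_eq. Qed.

Lemma to_quotK (q : Q) : to_quot (val q) = q.
Proof. by apply: val_inj; apply/eqP; exact: (valP q). Qed.

Lemma to_quot_eqP x y : to_quot x = to_quot y <-> N (x - y).
Proof.
split; last exact: to_quot_eq.
move=> /(congr1 val) /= h.
have := submodB hN (coset_repP x) (coset_repP y); rewrite h.
by rewrite opprB addrA subrK.
Qed.

Definition qadd (p q : Q) := to_quot (val p + val q).
Definition qopp (p : Q) := to_quot (- val p).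
Definition qscale (r : S) (p : Q) := to_quot (r *: val p).

Lemma qaddE x y : qadd (to_quot x) (to_quot y) = to_quot (x + y).
Proof.
by apply/esym/to_quot_eq; rewrite opprD addrACA; exact: (submodD hN (coset_repP x) (coset_repP y)).
Qed.
Lemma qoppE x : qopp (to_quot x) = to_quot (- x).
Proof. by apply/esym/to_quot_eq; rewrite -opprD; exact: (submodN hN (coset_repP x)). Qed.
Lemma qscaleE r x : qscale r (to_quot x) = to_quot (r *: x).
Proof. by apply/esym/to_quot_eq; rewrite -scalerBr; exact: (submodZ hN r (coset_repP x)). Qed.

Lemma qaddA : associative qadd.
Proof.
by move=> p q r; rewrite -(to_quotK p) -(to_quotK q) -(to_quotK r) !qaddE addrA.
Qed.
Lemma qaddC : commutative qadd.
Proof. by move=> p q; rewrite /qadd addrC. Qed.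
Lemma qadd0 : left_id (to_quot 0) qadd.
Proof. by move=> p; rewrite -(to_quotK p) qaddE add0r. Qed.
Lemma qaddN : left_inverse (to_quot 0) qopp qadd.
Proof. by move=> p; rewrite -(to_quotK p) qoppE qaddE addNr. Qed.
HB.instance Definition _ := GRing.isZmodule.Build Q qaddA qaddC qadd0 qaddN.

Lemma qscaleA a b v : qscale a (qscale b v) = qscale (a * b) v.
Proof. by rewrite -(to_quotK v) !qscaleE scalerA. Qed.
Lemma qscale1 : left_id 1 qscale.
Proof. by move=> v; rewrite -(to_quotK v) qscaleE scale1r. Qed.
Lemma qscaleDr : right_distributive qscale +%R.
Proof.
move=> a p q; rewrite -(to_quotK p) -(to_quotK q) [LHS](congr1 _ (qaddE _ _)).
by rewrite !qscaleE [RHS]qaddE scalerDr.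
Qed.
Lemma qscaleDl v : {morph qscale^~ v : a b / a + b}.
Proof. by move=> a b; rewrite -(to_quotK v) !qscaleE [RHS]qaddE scalerDl. Qed.
HB.instance Definition _ :=
  GRing.Zmodule_isLmodule.Build S Q qscaleA qscale1 qscaleDr qscaleDl.

Lemma to_quot_linear : linear to_quot.
Proof. by move=> r x y; rewrite -qaddE -qscaleE. Qed.
HB.instance Definition _ := GRing.isLinear.Build S L Q *:%R to_quot to_quot_linear.

Definition proj : {linear L -> Q} := to_quot.

Lemma proj_surj : surj proj.
Proof. by move=> q; exists (val q); exact: to_quotK. Qed.

Lemma proj_eq0 x : proj x = 0 <-> N x.
Proof. by rewrite -[0 : Q](linear0 proj) to_quot_eqP subr0. Qed.

Lemma proj_exact (U : Type) (f : U -> L) :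
  (forall y, N y <-> exists x, f x = y) -> exact f proj.
Proof. by move=> h y; apply: iff_trans (proj_eq0 y) (h y). Qed.
End Quotient.

(** The universal property of a cokernel, for any surjection.  Images are represented
    as quotients throughout, and this is how maps out of them arise. *)
Lemma surj_factor (S : pzRingType) (L Q E : lmodType S) (p : {linear L -> Q})
    (g : {linear L -> E}) :
  surj p -> (forall x, p x = 0 -> g x = 0) ->
  exists h : {linear Q -> E}, forall x, h (p x) = g x.
Proof.
move=> ps pg; have [s hs] := choice ps.
have gs x : g (s (p x)) = g x.
  apply/eqP; rewrite -subr_eq0 -linearB; apply/eqP/pg.
  by rewrite linearB hs subrr.
suff /linear_ex[h hE] : linear (g \o s) by exists h => x; rewrite hE /= gs.
move=> r x y /=.
by rewrite -{1}(hs x) -{1}(hs y) -linearP gs linearP.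
Qed.

(** Injectivity against maps that need not be mono: it suffices that [g] kills
    the kernel. *)
Lemma inj_factor (S : pzRingType) (A B E : lmodType S) (f : {linear A -> B})
    (g : {linear A -> E}) :
  injective_module E -> (forall x, f x = 0 -> g x = 0) ->
  exists h : {linear B -> E}, forall x, h (f x) = g x.
Proof.
move=> hE fg; pose K := submod_ker f.
have [x /proj_eq0 //|f' f'E] := @surj_factor _ _ _ _ (proj K) f (@proj_surj _ _ _ K).
have [x /proj_eq0 /fg //|g' g'E] := @surj_factor _ _ _ _ (proj K) g (@proj_surj _ _ _ K).
have f'i : injective f'.
  apply: lin_inj => q; have [x <-] := proj_surj q.
  by rewrite f'E => fx; apply/proj_eq0.
have [h hE'] := hE _ _ f' g' f'i.
by exists h => x; rewrite -f'E hE' g'E.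
Qed.

(** Products of arbitrary families are needed to embed a module in a product of
    coinduced modules; finite ones serve as direct sums. *)
Section Dprod.
Variables (S : pzRingType) (T : Type) (V : T -> lmodType S).
Definition dprod : Type := forall i, V i.
HB.instance Definition _ := gen_eqMixin dprod.
HB.instance Definition _ := gen_choiceMixin dprod.
Implicit Types f g : dprod.
Definition dadd f g : dprod := fun i => f i + g i.
Definition dopp f : dprod := fun i => - f i.
Definition dscale (r : S) f : dprod := fun i => r *: f i.
Lemma dprodP f g : (forall i, f i = g i) -> f = g.
Proof. exact: functional_extensionality_dep. Qed.
Lemma daddA : associative dadd.
Proof. by move=> f g h; apply: dprodP => i; exact: addrA. Qed.
Lemma daddC : commutative dadd.
Proof. by move=> f g; apply: dprodP => i; exact: addrC. Qed.
Lemma dadd0 : left_id ((fun i => 0) : dprod) dadd.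
Proof. by move=> f; apply: dprodP => i; exact: add0r. Qed.
Lemma daddN : left_inverse ((fun i => 0) : dprod) dopp dadd.
Proof. by move=> f; apply: dprodP => i; exact: addNr. Qed.
HB.instance Definition _ := GRing.isZmodule.Build dprod daddA daddC dadd0 daddN.
Lemma dscaleA a b f : dscale a (dscale b f) = dscale (a * b) f.
Proof. by apply: dprodP => i; exact: scalerA. Qed.
Lemma dscale1 : left_id 1 dscale.
Proof. by move=> f; apply: dprodP => i; exact: scale1r. Qed.
Lemma dscaleDr : right_distributive dscale +%R.
Proof. by move=> a f g; apply: dprodP => i; exact: scalerDr. Qed.
Lemma dscaleDl f : {morph dscale^~ f : a b / a + b}.
Proof. by move=> a b; apply: dprodP => i; exact: scalerDl. Qed.
HB.instance Definition _ :=
  GRing.Zmodule_isLmodule.Build S dprod dscaleA dscale1 dscaleDr dscaleDl.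

Lemma dprod_sum (I : Type) (r : seq I) (P : pred I) (F : I -> dprod) i :
  (\sum_(j <- r | P j) F j) i = \sum_(j <- r | P j) F j i.
Proof. by elim/big_rec2: _ => // j y z _ <-. Qed.

Lemma dprod_pair (U : lmodType S) (f : forall i, {linear U -> V i}) :
  exists g : {linear U -> dprod}, forall x i, g x i = f i x.
Proof.
have [r x y|g gE] := @linear_ex S U dprod (fun x i => f i x).
  by apply: dprodP => i; rewrite linearP.
by exists g => x i; rewrite gE.
Qed.

Lemma dprod_eval i : exists g : {linear dprod -> V i}, forall f, g f = f i.
Proof. by have [//|g gE] := @linear_ex S dprod (V i) (fun f => f i); exists g. Qed.

Lemma dprod_injective : (forall i, injective_module (V i)) -> injective_module dprod.
Proof.
move=> hV A B f g fi.
have ex i : exists h : {linear B -> V i}, forall x, h (f x) = g x i.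
  have [ev evE] := dprod_eval i; have [h hE] := hV i A B f (ev \o g) fi.
  by exists h => x; rewrite hE /= evE.
pose h i := projT1 (cid (ex i)); have hE i := projT2 (cid (ex i)).
have [k kE] := dprod_pair h.
by exists k => x; apply: dprodP => i; rewrite kE; exact: hE.
Qed.
End Dprod.

(** * Injective envelopes *)

Definition meet0 (S : pzRingType) (L : lmodType S) (A C : L -> Prop) :=
  forall x, A x -> C x -> x = 0.

(** The one use of Zorn's lemma: over the integers it extends homomorphisms into
    divisible groups, over [S] it gives the complements that define envelopes. *)
Lemma max_meet0 (S : pzRingType) (L : lmodType S) (A C : L -> Prop) :
  is_submodule A -> meet0 A C ->
  exists V : L -> Prop, [/\ is_submodule V, forall x, A x -> V x, meet0 V C
    & forall W : L -> Prop, is_submodule W -> (forall x, V x -> W x) -> meet0 W C ->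
      forall x, W x -> V x].
Proof.
move=> hA AC.
pose P (V : L -> Prop) := [/\ is_submodule V, forall x, A x -> V x & meet0 V C].
pose T := {V : L -> Prop | P V}.
pose R (V W : T) := `[< forall x, sval V x -> sval W x >].
have PA : P A by split.
have [| |F tot|[V [hV AV VC]] Vmax] := @ZL_preorder T (exist P A PA) R.
- by move=> V; exact/asboolP.
- move=> U V W /asboolP UV /asboolP VW; apply/asboolP => x /UV; exact: VW.
- have [[V0 FV0]|F0] := pselect (exists V, F V); last first.
    by exists (exist P A PA) => V FV; case: F0; exists V.
  pose U x := exists2 V : T, F V & sval V x.
  have chain x y : U x -> U y -> exists V : T, [/\ F V, sval V x & sval V y].
    move=> [V FV Vx] [W FW Wy].
    have [/asboolP VW|/asboolP WV] := tot _ _ FV FW.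
      by exists W; split=> //; exact: VW.
    by exists V; split=> //; exact: WV.
  have PU : P U.
    split.
    - split; first by exists V0 => //; case: (svalP V0) => h _ _; exact: (submod0 h).
      + move=> x y Ux Uy; have [V [FV Vx Vy]] := chain _ _ Ux Uy.
        by exists V => //; case: (svalP V) => h _ _; exact: (submodD h).
      + move=> r x [V FV Vx]; exists V => //.
        by case: (svalP V) => h _ _; exact: (submodZ h).
    - by move=> x Ax; exists V0 => //; case: (svalP V0) => _ h _; exact: h.
    - by move=> x [V FV Vx]; case: (svalP V) => _ _; exact.
  exists (exist P U PU) => V FV; apply/asboolP => x /= Vx.
  by exists V.
exists V; split=> // W hW VW WC.
have PW : P W by split=> // x /AV; exact: VW.
have /asboolP : R (exist P W PW) (exist P V (And3 hV AV VC)).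
  by apply: Vmax; apply/asboolP.
exact.
Qed.

Definition divisible (D : zmodType) :=
  forall (d : D) (n : nat), exists d' : D, d' *+ n.+1 = d.

(** Relations between a group and a divisible group, viewed as subgroups of the
    product; being single-valued means meeting the second factor trivially, so
    a maximal single-valued relation comes from [max_meet0] over the integers.
    Divisibility makes it total. *)
Lemma divisible_extend (B D : zmodType) (G : B * D -> Prop) :
  divisible D ->
  G 0 -> (forall x y, G x -> G y -> G (x - y)) -> (forall d, G (0, d) -> d = 0) ->
  exists h : {additive B -> D}, forall b d, G (b, d) -> h b = d.
Proof.
move=> divD G0 GB Guniq.
pose L : lmodType int := (zmodule (B * D)%type).
have GN x : G x -> G (- x) by move=> gx; rewrite -sub0r; exact: GB.
have GD x y : G x -> G y -> G (x + y) by move=> gx /GN; rewrite -{2}(opprK y); exact: GB.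
have GZ (n : nat) x : G x -> G (x *+ n).
  by move=> gx; elim: n => [|n ih]; rewrite ?mulr0n // mulrS; exact: GD.
have hG : @is_submodule _ L G.
  split=> // -[n|n] x gx; rewrite scalezrE; first by rewrite -pmulrn; exact: GZ.
  by rewrite NegzE mulrNz -pmulrn; apply/GN/GZ.
have GC : @meet0 _ L G (fun x => x.1 = 0).
  by move=> [b d] /= gbd b0; move: gbd; rewrite b0 => /Guniq ->.
have [V [hV GV VC Vmax]] := max_meet0 hG GC.
have Vuniq b d d' : V (b, d) -> V (b, d') -> d = d'.
  move=> v v'; have := VC _ (submodB hV v v') (subrr _).
  by move=> /(congr1 snd)/eqP; rewrite subr_eq0 => /eqP.
have tot b : exists d, V (b, d).
  apply: contrapT => nb.
  pose I (n : nat) := exists d, V (b *+ n, d).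
  (* the multiples of b in the domain form an ideal; d0 is a compatible value *)
  have [d0 hd0] : exists d0, forall (n : int) d, V (b *~ n, d) -> d = d0 *~ n.
    have [[n0 hn0]|nI] := pselect (exists n, (0 < n)%N /\ I n); last first.
      exists 0; have pos n d : V (b *~ Posz n, d) -> d = 0.
        case: n => [|n]; last by move=> h; case: nI; exists n.+1; split=> //; exists d; rewrite pmulrn.
        by rewrite mulr0z => /VC /= /(_ erefl) [].
      move=> [n|n] d; first by move=> /pos ->; rewrite mul0rz.
      rewrite NegzE mul0rz mulrNz => /(submodN hV) h.
      by apply/eqP; rewrite -oppr_eq0; apply/eqP/(pos n.+1); rewrite -[b *~ _]opprK.
    have ex : exists n, (0 < n)%N && `[< I n >].
      by exists n0; case: hn0 => -> ?; apply/asboolP.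
    have [m /andP[m0 /asboolP[d hd]] mmin] := ex_minnP ex.
    have [d0 hd0] := divD d m.-1; rewrite prednK // in hd0.
    exists d0 => n e hne.
    have hq := submodZ hV (n %/ m)%Z hd.
    have := submodB hV hne hq; rewrite scalezrE.
    have -> : (b *~ n, e) - ((b *+ m, d) : B * D) *~ (n %/ m)%Z =
       (b *~ (n %% m)%Z, e - d *~ (n %/ m)%Z).
      have -> : ((b *+ m, d) : B * D) *~ (n %/ m)%Z =
         (b *+ m *~ (n %/ m)%Z, d *~ (n %/ m)%Z).
        rewrite [LHS]surjective_pairing; congr pair.
          by rewrite (raddfMz (fst : {additive B * D -> B})).
        by rewrite (raddfMz (snd : {additive B * D -> D})).
      rewrite -[LHS]/(_ - _, _ - _); congr pair.
      rewrite {1}(divz_eq n m) mulrzDr pmulrn -mulrzA mulrC.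
      by rewrite [_ + b *~ (n %% m)%Z]addrC addrK.
    have nm : (0 <= (n %% m)%Z)%R by apply: modz_ge0; case: (m) m0.
    have lt : ((n %% m)%Z < m)%R by apply: ltz_pmod.
    have := divz_eq n m.
    case: (n %% m)%Z nm lt => // r _ rm nE hr.
    have r0 : r = 0%N.
      case: r rm hr nE => // r rm hr _.
      have : (m <= r.+1)%N by apply: mmin; apply/andP; split=> //; apply/asboolP; eexists; rewrite pmulrn; exact: hr.
      by rewrite leqNgt -ltz_nat rm.
    move: hr; rewrite r0 mulr0z => /VC /= /(_ erefl) [] /eqP; rewrite subr_eq0 => /eqP ->.
    by rewrite -hd0 pmulrn -mulrzA {2}nE r0 addr0 mulrC.
  (* adding (b, d0) to V keeps it single-valued, against maximality *)
  pose W (x : L) := exists (n : int) (v : L), V v /\ x = v + (b *~ n, d0 *~ n).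
  case: nb; exists d0.
  apply: (Vmax W).
  - split.
    + exists 0, 0; split; first exact: (submod0 hV).
      by rewrite !mulr0z; rewrite -[RHS]/(0+0, 0+0) !addr0.
    + move=> _ _ [n [v [Vv ->]]] [n' [v' [Vv' ->]]].
      exists (n + n'), (v + v'); split; first exact: (submodD hV).
      by rewrite !mulrzDr addrACA.
    + move=> r _ [n [v [Vv ->]]]; exists (n * r), (r *: v); split; first exact: (submodZ hV).
      rewrite scalerDr; congr (_ + _); rewrite scalezrE !mulrzA.
      rewrite [LHS]surjective_pairing; congr pair.
        by rewrite (raddfMz (fst : {additive B * D -> B})).
      by rewrite (raddfMz (snd : {additive B * D -> D})).
  - by move=> x Vx; exists 0, x; split=> //; rewrite !mulr0z; rewrite -[(0,0)]/(0 : L) addr0.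
  - move=> _ [n [[b1 d1] [Vv ->]]] /= h.
    have b1E : b1 = - (b *~ n) by apply/eqP; rewrite -addr_eq0 h.
    have /hd0 : V (b *~ n, - d1) by have := submodN hV Vv; rewrite b1E -[- (_,_)]/(_,_) opprK.
    move=> d1E; rewrite -[LHS]/(_ + _, _ + _) -d1E subrr b1E addNr //.
  - by exists 1, 0; split; [exact: (submod0 hV)|rewrite add0r !mulr1z].
have [h hh] := choice tot.
have had : zmod_morphism h.
  by move=> x y; apply: Vuniq (hh _) _; exact: (submodB hV (hh x) (hh y)).
pose hm := GRing.isZmodMorphism.Build B D h had.
pose ha : {additive B -> D} := HB.pack h hm.
by exists ha => b d /GV; exact: Vuniq (hh b).
Qed.

Lemma divfn (x : rat) n : (x / n.+1%:R : zmodule rat) *+ n.+1 = x.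
Proof.
by rewrite -[LHS]/((x / n.+1%:R) *+ n.+1) -mulr_natr mulfVK // Num.Theory.pnatr_eq0.
Qed.

(** The group is Q/Z.  An element [y] of order [m] can be sent to [1/m], and an
    element of infinite order to [1/2]. *)
Lemma divisible_cogenerator : exists D : zmodType, divisible D /\
  forall (B : zmodType) (y : B), y <> 0 -> exists h : {additive B -> D}, h y <> 0.
Proof.
pose Q : lmodType int := (zmodule rat).
pose Z (x : Q) := exists n : int, x = n%:~R :> rat.
have hZ : is_submodule Z.
  split; first by exists 0.
  - by move=> _ _ [n ->] [m ->]; exists (n + m); rewrite rmorphD.
  - by move=> r _ [n ->]; exists (r * n); rewrite scalezrE -mulrzl rmorphM.
pose D : zmodType := quot hZ; exists D.
pose p : {linear Q -> quot hZ} := proj hZ.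
have divD : divisible D.
  move=> d n; have [x <-] := proj_surj d.
  exists (p ((x : rat) / n.+1%:R)); rewrite -raddfMn; congr (p _).
  by apply: divfn.
split=> //.
have cyc m : (1 < m)%N -> exists d : D, d <> 0 /\ d *+ m = 0.
  move=> m1; have m0 : (m%:R : rat) != 0 by rewrite Num.Theory.pnatr_eq0; case: m m1.
  exists (p ((m%:R : rat)^-1)); split.
    move=> /proj_eq0[n nE].
    have : (n * m = 1 :> int).
      apply: (@intr_inj rat); rewrite rmorphM /= -nE -pmulrn mulVf //.
    by move=> /(congr1 absz) /eqP; rewrite abszM muln_eq1 => /andP[_ /eqP m1']; move: m1; rewrite -[m]/(absz m) m1'.
  rewrite -raddfMn; apply/proj_eq0; exists 1.
  by rewrite -[LHS]/((m%:R : rat)^-1 *+ m) -[LHS]mulr_natr mulVf.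
move=> B y y0.
have [d [d0 hd]] : exists d : D, d <> 0 /\ forall n : nat, y *+ n = 0 -> d *+ n = 0.
  have [[n0 hn0]|tf] := pselect (exists n, (0 < n)%N && (y *+ n == 0)); last first.
    have [d [d0 _]] := cyc 2 isT; exists d; split=> // -[//|n] yn.
    by case: tf; exists n.+1; apply/eqP.
  have ex : exists n, (0 < n)%N && (y *+ n == 0) by exists n0.
  have [m /andP[m0 /eqP ym] mmin] := ex_minnP ex.
  have m1 : (1 < m)%N by case: m m0 ym {mmin} => [//|[|//]] _ /y0.
  have [d [d0 dm]] := cyc m m1; exists d; split=> // n yn.
  have : y *+ (n %% m) = 0.
    by move: yn; rewrite {1}(divn_eq n m) mulrnDr mulnC mulrnA ym mul0rn add0r.
  case E: (n %% m)%N => [|r] yr; last first.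
    have : (m <= r.+1)%N by apply: mmin; rewrite /= yr.
    by rewrite -E leqNgt ltn_mod m0.
  by rewrite (divn_eq n m) E addn0 mulnC mulrnA dm mul0rn.
pose G (x : B * D) := exists n : int, x = (y *~ n, d *~ n).
have hdz (n : int) : y *~ n = 0 -> d *~ n = 0.
  case: n => n; first by rewrite -!pmulrn; exact: hd.
  rewrite NegzE !mulrNz => /eqP; rewrite oppr_eq0 -!pmulrn => /eqP/hd ->.
  by rewrite oppr0.
have [| |d' |h hE] := @divisible_extend B D G divD.
- by exists 0.
- by move=> _ _ [n ->] [m ->]; exists (n - m); rewrite !mulrzBr.
- by move=> [n [/esym/hdz yn ->]].
by exists h; rewrite (hE y d) //; exists 1; rewrite !mulr1z.
Qed.

Section Coinduced.
Variables (S : pzRingType) (D : zmodType).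

(** [Hom_Z(S, D)] with the left action [(r f) s = f (s r)]. *)
Record coind := Coind { coind_fun : S -> D; coind_add : zmod_morphism coind_fun }.
HB.instance Definition _ := gen_eqMixin coind.
HB.instance Definition _ := gen_choiceMixin coind.
Implicit Types f g : coind.

Lemma coindP f g : (forall s, coind_fun f s = coind_fun g s) -> f = g.
Proof.
case: f g => [f hf] [g hg] /= E.
have {E} E : f = g by exact: functional_extensionality_dep.
by case: _ / E hg => hg; congr Coind; exact: Prop_irrelevance.
Qed.

Lemma coind_zero_add : zmod_morphism (fun _ : S => 0 : D).
Proof. by move=> x y; rewrite subr0. Qed.
Lemma coind_add_add f g : zmod_morphism (fun s => coind_fun f s + coind_fun g s).
Proof. by move=> x y; rewrite !coind_add opprD addrACA. Qed.
Lemma coind_opp_add f : zmod_morphism (fun s => - coind_fun f s).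
Proof. by move=> x y; rewrite !coind_add opprD. Qed.
Lemma coind_scale_add (r : S) f : zmod_morphism (fun s => coind_fun f (s * r)).
Proof. by move=> x y; rewrite mulrBl coind_add. Qed.
Definition cadd f g := Coind (coind_add_add f g).
Definition copp f := Coind (coind_opp_add f).
Definition cscale r f := Coind (coind_scale_add r f).
Lemma caddA : associative cadd.
Proof. by move=> f g h; apply: coindP => s; exact: addrA. Qed.
Lemma caddC : commutative cadd.
Proof. by move=> f g; apply: coindP => s; exact: addrC. Qed.
Lemma cadd0 : left_id (Coind coind_zero_add) cadd.
Proof. by move=> f; apply: coindP => s; exact: add0r. Qed.
Lemma caddN : left_inverse (Coind coind_zero_add) copp cadd.
Proof. by move=> f; apply: coindP => s; exact: addNr. Qed.
HB.instance Definition _ := GRing.isZmodule.Build coind caddA caddC cadd0 caddN.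
Lemma cscaleA a b f : cscale a (cscale b f) = cscale (a * b) f.
Proof. by apply: coindP => s /=; rewrite mulrA. Qed.
Lemma cscale1 : left_id 1 cscale.
Proof. by move=> f; apply: coindP => s /=; rewrite mulr1. Qed.
Lemma cscaleDr : right_distributive cscale +%R.
Proof. by move=> a f g; apply: coindP. Qed.
Lemma cscaleDl f : {morph cscale^~ f : a b / a + b}.
Proof.
move=> a b; apply: coindP => s /=; rewrite mulrDr -{1}[s * b]opprK.
by rewrite coind_add -[- (s * b)]sub0r coind_add -{1}[0](subrr 0) coind_add subrr sub0r opprK.
Qed.
HB.instance Definition _ :=
  GRing.Zmodule_isLmodule.Build S coind cscaleA cscale1 cscaleDr cscaleDl.

(** Coinduction is right adjoint to the forgetful functor to groups, so it turns
    divisible groups into injective modules. *)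
Lemma coind_map (B : lmodType S) (h : {additive B -> D}) :
  exists g : {linear B -> coind}, forall b s, coind_fun (g b) s = h (s *: b).
Proof.
have had b : zmod_morphism (fun s => h (s *: b)).
  by move=> x y; rewrite scalerBl raddfB.
have [r x y|g gE] := @linear_ex S B coind (fun b => Coind (had b)).
  by apply: coindP => s /=; rewrite scalerDr raddfD scalerA.
by exists g => b s; rewrite gE.
Qed.

Lemma coind_injective : divisible D -> injective_module coind.
Proof.
move=> divD A B i g ii.
pose G (x : B * D) := exists a, x = (i a, coind_fun (g a) 1).
have cB f f' s : coind_fun (f - f') s = coind_fun f s - coind_fun f' s by [].
have [| | d | h hE] := @divisible_extend B D G divD.
- by exists 0; rewrite !linear0.
- by move=> _ _ [a ->] [a' ->]; exists (a - a'); rewrite !linearB cB.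
- by move=> [a [/esym ia ->]]; rewrite (inj_lin0 ii ia) linear0.
have [k kE] := coind_map h; exists k => a; apply: coindP => s.
rewrite kE -linearZ (hE _ (coind_fun (g (s *: a)) 1)); last by exists (s *: a).
by rewrite linearZ /= mul1r.
Qed.
End Coinduced.

Lemma enough_injectives (S : pzRingType) (M : lmodType S) :
  exists (E : lmodType S) (f : {linear M -> E}), injective_module E /\ injective f.
Proof.
have [D [divD Dcog]] := divisible_cogenerator.
have ex (y : M) : exists g : {linear M -> coind S D}, y <> 0 -> g y <> 0.
  have [->|/eqP y0] := eqVneq y 0; first by exists \0.
  have [h hy] := Dcog M y y0; have [g gE] := coind_map h.
  exists g => _ /(congr1 (fun f => coind_fun f 1)); rewrite gE scale1r; exact: hy.
pose g y := projT1 (cid (ex y)); have hg y : y <> 0 -> g y y <> 0 := projT2 (cid (ex y)).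
have [f fE] := dprod_pair g.
exists (dprod (fun _ : M => coind S D)), f; split.
  by apply: dprod_injective => _; exact: coind_injective.
apply: lin_inj => y fy; apply: contrapT => /hg; apply.
by rewrite -fE fy.
Qed.

(** Direct summands are handled as retracts, which compose and need no complement. *)
Definition retract (S : pzRingType) (U V : lmodType S) :=
  exists (s : {linear U -> V}) (r : {linear V -> U}), forall x, r (s x) = x.

Lemma retract_injective (S : pzRingType) (U V : lmodType S) :
  retract U V -> injective_module V -> injective_module U.
Proof.
move=> [s [r rs]] hV A B i g ii.
have [h hE] := hV A B i (s \o g) ii.
by exists (r \o h) => x; rewrite /= hE /= rs.
Qed.

(** The envelope is found as a quotient [E/C] of an injective [E] containing [M],
    where [C] is maximal with [C] meeting [M] trivially.  If [V] is maximal among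
    the submodules containing [M] and meeting [C] trivially, then [V] is a
    complement of [C], so [E/C] is a direct summand of [E]. *)
Lemma injective_envelope (S : pzRingType) (M : lmodType S) :
  exists (E : lmodType S) (f : {linear M -> E}),
    [/\ injective_module E, injective f & essential_image f].
Proof.
have [E [f [hE fi]]] := enough_injectives M.
pose K (y : E) := exists x, f x = y.
have hK : is_submodule K := submod_range f.
have [|C [hC _ CK Cmax]] := max_meet0 (submod_zero E) (C := K); first by move=> x -> _.
have [|V [hV KV VC Vmax]] := max_meet0 hK (C := C).
  by move=> x Kx Cx; exact: CK.
pose p : {linear E -> quot hC} := proj hC.
have pK x : K x -> p x = 0 -> x = 0 by move=> Kx /proj_eq0 Cx; exact: CK.
have pess N : is_submodule N -> (exists2 y, N y & y <> 0) ->
    exists2 x, N (p (f x)) & p (f x) <> 0.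
  move=> hN [y Ny y0]; apply: contrapT => no.
  have [e ye] := proj_surj y.
  apply: y0; rewrite -ye; apply/proj_eq0.
  apply: (Cmax (fun e => N (p e))).
  - exact: submod_preim.
  - move=> x Cx; have -> : p x = 0 by exact/proj_eq0.
    exact: submod0.
  - move=> x Nx [z zx]; apply: contrapT => x0; case: no; exists z; rewrite zx //.
    by move=> /(pK x) h; apply/x0/h; exists z.
  - by rewrite /p ye.
exists (quot hC), (p \o f); split; last first.
- exact: pess.
- by apply: lin_inj => x px; apply: (inj_lin0 fi); apply: pK px; exists x.
have hidV : forall x, V x -> p x = 0 -> x = 0 by move=> x Vx /proj_eq0; exact: VC.
(* E embeds in E/C x E/V; a retraction of this embedding restricts to the wanted
   extension of the inclusion of V *)
have [g gV] : exists g : {linear quot hC -> E}, forall x, V x -> g (p x) = x.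
  pose q : {linear E -> quot hV} := proj hV.
  have [r x y|m mE] := @linear_ex S E (quot hC * quot hV)%type (fun x => (p x, q x)).
    by rewrite !linearP.
  have mi : injective m.
    apply: lin_inj => x; rewrite mE => E0.
    have Cx := (proj_eq0 hC x).1 (congr1 fst E0).
    have Vx := (proj_eq0 hV x).1 (congr1 snd E0).
    exact: VC.
  have [rho rhoE] := hE _ _ m idfun mi.
  have [r x y|g gE] := @linear_ex S (quot hC) E (fun y => rho (y, 0)).
    rewrite -linearP; congr (rho _).
    by rewrite -[RHS]/(_, r *: 0 + 0) scaler0 addr0.
  exists g => x Vx; have qx : q x = 0 by exact/proj_eq0.
  by rewrite gE -[RHS]rhoE mE qx.
pose W (x : E) := exists y, g y = x.
have VW x : V x -> W x by move=> /gV <-; exists (p x).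
have gi : injective g.
  apply: lin_inj => y gy; apply: contrapT => y0.
  have [|x] := pess (fun y => g y = 0) (submod_ker g); first by exists y.
  rewrite gV; last by apply: KV; exists x.
  by move=> ->; rewrite linear0.
have WV : forall x, W x -> V x.
  apply: Vmax => //; first exact: submod_range.
  move=> _ [y <-] Cgy; apply: contrapT => gy0.
  have y0 : y <> 0 by move=> y0; apply: gy0; rewrite y0 linear0.
  have [|x [r rE] x0] := pess _ (submod_span1 y); first by exists y => //; exists 1; rewrite scale1r.
  have Kx : K (f x) by exists x.
  have gpf : g (p (f x)) = f x by apply/gV/KV.
  have E2 : f x = r *: g y by rewrite -gpf -linearZ; congr (g _).
  apply: x0; rewrite /= (CK (f x)) ?linear0 //.
  by rewrite E2; exact: submodZ.
apply: (@retract_injective _ _ E) hE; exists g, p => y.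
have [e eE] := proj_surj y; rewrite -{2}eE.
apply: gi; rewrite gV; last by apply: WV; eexists.
by rewrite eE.
Qed.

(** * Injective resolutions *)

(** Chosen envelopes, which make the iteration of cosyzygies a plain recursion. *)
Section MinimalResolution.
Variables (S : pzRingType).
Implicit Types M : lmodType S.

Definition envelope M : lmodType S := projT1 (cid (injective_envelope M)).
Definition to_envelope M : {linear M -> envelope M} :=
  projT1 (cid (projT2 (cid (injective_envelope M)))).
Lemma envelopeP M :
  [/\ injective_module (envelope M), injective (to_envelope M)
    & essential_image (to_envelope M)].
Proof. exact: projT2 (cid (projT2 (cid (injective_envelope M)))). Qed.

Fixpoint cosyzygy M j : lmodType S :=
  if j is i.+1 then quot (submod_range (to_envelope (cosyzygy M i))) else M.

Lemma min_inj_res_exists M : inhabited (min_inj_res M).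
Proof.
pose I j := envelope (cosyzygy M j).
pose p j : {linear I j -> cosyzygy M j.+1} := proj _.
pose d j : {linear I j -> I j.+1} := to_envelope (cosyzygy M j.+1) \o p j.
have dE j y : d j y = 0 <-> exists x, to_envelope (cosyzygy M j) x = y.
  rewrite -(proj_eq0 (submod_range (to_envelope (cosyzygy M j)))).
  have [_ ei _] := envelopeP (cosyzygy M j.+1).
  by split=> [/(inj_lin0 ei)|h]; rewrite // /d /= /p h linear0.
split; apply: (@MinInjRes S M I (to_envelope M) d).
- by move=> j; case: (envelopeP (cosyzygy M j)).
- by case: (envelopeP M).
- exact: (dE 0%N).
- move=> j y; rewrite dE; split=> [[x <-]|[x <-]]; last by eexists.
  by have [z <-] := @proj_surj _ _ _ (submod_range (to_envelope (cosyzygy M j))) x; exists z.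
- by case: (envelopeP M).
- move=> j N hN Ny; have [_ _ /(_ N hN Ny)[x Nx x0]] := envelopeP (cosyzygy M j.+1).
  have [z zx] := @proj_surj _ _ _ (submod_range (to_envelope (cosyzygy M j))) x.
  by exists z; rewrite /= zx.
Qed.
End MinimalResolution.

Definition ses (S : pzRingType) (A B C : lmodType S) (f : {linear A -> B})
    (g : {linear B -> C}) :=
  [/\ injective f, exact f g & surj g].

(** [inj_term b l M J]: the module [J] is the [l]-th term of an injective
    resolution of [M], minimal when [b] holds.  Recursion on short exact sequences
    replaces the manipulation of complexes. *)
Fixpoint inj_term (S : pzRingType) (b : bool) (l : nat) (M J : lmodType S) : Prop :=
  if l is l'.+1 then
    exists (E C : lmodType S) (f : {linear M -> E}) (g : {linear E -> C}),
      [/\ injective_module E, ses f g, b -> essential_image f & inj_term b l' C J]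
  else injective_module J /\
    exists f : {linear M -> J}, injective f /\ (b -> essential_image f).

Section InjTerm.
Variables (S : pzRingType).
Implicit Types (M N C P J E U V : lmodType S).

Lemma ses_proj U V (f : {linear U -> V}) : injective f -> ses f (proj (submod_range f)).
Proof.
move=> fi; split=> //; last exact: proj_surj.
by apply: proj_exact.
Qed.

Lemma mir_inj_term b l M (I : min_inj_res M) : inj_term b l M (I l).
Proof.
elim: l M I => [|l ih] M I.
  split; first exact: mir_injective.
  by exists (mir_aug I); split; [exact: mir_aug_inj|move=> _; exact: mir_essential0].
have h := ses_proj (@mir_aug_inj _ _ I).
set p := proj _ in h; have [_ pex ps] := h.
have [x /pex /mir_exact0 //|g gE] := surj_factor (g := mir_diff I 0) ps.
have gi : injective g.
  apply: lin_inj => y; have [x <-] := ps y.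
  by rewrite gE => /mir_exact0/pex.
have gim y : (exists x, g x = y) <-> exists x, mir_diff I 0 x = y.
  split=> [[x <-]|[x <-]]; last by exists (p x).
  by have [z <-] := ps x; exists z; rewrite gE.
have gex : exact g (mir_diff I 1) by move=> y; rewrite gim; exact: mir_exact.
have gess : essential_image g.
  move=> N hN Ny; have [x Nx x0] := mir_essential (m := I) (j := 0%N) hN Ny.
  by exists (p x); rewrite gE.
pose I' := @MinInjRes _ _ (fun j => I j.+1) g (fun j => mir_diff I j.+1)
  (fun j => mir_injective (m := I) (j := j.+1)) gi gex
  (fun j => mir_exact (m := I) (j := j.+1)) gess
  (fun j => mir_essential (m := I) (j := j.+1)).
exists (I 0%N), (quot (submod_range (mir_aug I))), (mir_aug I), p; split=> //.
- exact: mir_injective.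
- by move=> _; exact: mir_essential0.
- exact: (ih _ I').
Qed.

Lemma essential_inj U V E (f : {linear U -> V}) (h : {linear V -> E}) :
  essential_image f -> (forall x, h (f x) = 0 -> x = 0) -> injective h.
Proof.
move=> fess hf; apply: lin_inj => y hy; apply: contrapT => y0.
have [|x /hf ->] := fess _ (submod_ker h); first by exists y.
by rewrite linear0.
Qed.

(** For the induction the statement allows [Z] to be a summand of [C]: the cosyzygy
    of [Z] is then a summand of the cosyzygy of [C], because an endomorphism of the
    envelope of [Z] that is the identity on [Z] is an automorphism, and composing
    with its inverse makes the lifted maps [h] and [rho] into a retraction. *)
Lemma inj_term_retract l (Z C I J : lmodType S) :
  retract Z C -> inj_term true l Z I -> inj_term false l C J -> retract I J.
Proof.
elim: l Z C I J => [|l ih] Z C I J [s [r rs]] /=.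
  move=> [hI [f [fi /(_ isT) fess]]] [hJ [k [ki _]]].
  have [h hE] := hJ _ _ f (k \o s) fi.
  have hi : injective h.
    apply: (essential_inj fess) => x; rewrite hE /= => /(inj_lin0 ki) sx.
    by rewrite -(rs x) sx linear0.
  by have [q qE] := hI _ _ h idfun hi; exists h, q.
move=> [E [Z1 [f [p [hE [fi pex ps] /(_ isT) fess tZ]]]]].
move=> [F [C1 [k [q [hF [ki qex qs] _ tC]]]]].
have [h hh] := hF _ _ f (k \o s) fi.
have [rho rhoE] := hE _ _ k (f \o r) ki.
pose phi : {linear E -> E} := rho \o h.
have phif x : phi (f x) = f x by rewrite /phi /= hh /= rhoE /= rs.
have phii : injective phi by apply: (essential_inj fess) => x; rewrite phif => /(inj_lin0 fi).
have [u uE] := hE _ _ phi idfun phii.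
have uf x : u (f x) = f x by rewrite -{1}phif uE.
have fq x : p x = 0 -> (q \o h) x = 0.
  by move=> /pex[z <-]; rewrite /= hh; apply/qex; eexists.
have fp x : q x = 0 -> (p \o (u \o rho)) x = 0.
  by move=> /qex[z <-]; rewrite /= rhoE /= uf; apply/pex; eexists.
have [h' h'E] := surj_factor ps fq.
have [r' r'E] := surj_factor qs fp.
apply: ih tZ tC; exists h', r' => y.
by have [x <-] := ps y; rewrite h'E /= r'E /=; congr (p _); exact: uE.
Qed.

Lemma prod_injective U V :
  injective_module U -> injective_module V -> injective_module (U * V)%type.
Proof.
move=> hU hV A B i g ii.
have [a aE] := hU _ _ i (fst \o g) ii; have [b bE] := hV _ _ i (snd \o g) ii.
have [r x y|h hE] := @linear_ex S B (U * V)%type (fun x => (a x, b x)).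
  by rewrite !linearP.
by exists h => x; rewrite hE aE bE /= -surjective_pairing.
Qed.

Lemma pair_map U V N (a : {linear N -> U}) (b : {linear N -> V}) :
  exists h : {linear N -> (U * V)%type}, forall x, h x = (a x, b x).
Proof.
have [r x y|h hE] := @linear_ex S N (U * V)%type (fun x => (a x, b x)).
  by rewrite !linearP.
by exists h.
Qed.

Lemma pair_inl U V : exists h : {linear U -> (U * V)%type}, forall x, h x = (x, 0).
Proof. by have [h hE] := pair_map (@idfun U : {linear U -> U}) (\0 : {linear U -> V}); exists h. Qed.

(** The horseshoe lemma: the maps [N -> E'], extended to [C], and [C -> C' -> E] embed
    [C] in [E' * E], and the cokernels again form a short exact sequence. *)
Lemma inj_term_ext l (N C C' J' J : lmodType S) (a : {linear N -> C})
    (b : {linear C -> C'}) :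
  ses a b -> inj_term false l N J' -> inj_term false l C' J ->
  inj_term false l C (J' * J)%type.
Proof.
have glue (N0 C0 C0' E' E : lmodType S) (a0 : {linear N0 -> C0}) (b0 : {linear C0 -> C0'})
    (f' : {linear N0 -> E'}) (f : {linear C0' -> E}) :
    ses a0 b0 -> injective_module E' -> injective f' -> injective f ->
    exists m : {linear C0 -> (E' * E)%type}, [/\ injective m, forall x, m (a0 x) = (f' x, 0)
      & forall x, (m x).2 = f (b0 x)].
  move=> [ai bex bs] hE' f'i fi.
  have [h hE] := hE' _ _ a0 f' ai.
  have [m mE] := pair_map h (f \o b0).
  have ba x : b0 (a0 x) = 0 by apply/bex; eexists.
  exists m; split=> [||x]; last by rewrite mE.
    apply: lin_inj => x; rewrite mE => -[hx /(inj_lin0 fi)/bex[n nx]].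
    by move: hx; rewrite -nx hE => /(inj_lin0 f'i) ->; rewrite linear0.
  by move=> x; rewrite mE hE /= ba linear0.
elim: l N C C' J' J a b => [|l ih] N C C' J' J a b h /=.
  move=> [hJ' [f' [f'i _]]] [hJ [f [fi _]]]; split; first exact: prod_injective.
  by have [m [mi _ _]] := glue _ _ _ _ _ _ _ _ _ h hJ' f'i fi; exists m.
move=> [E' [N1 [f' [p' [hE' sN _ tN]]]]] [E [C1' [f [p [hE sC _ tC]]]]].
have [f'i p'ex p's] := sN; have [fi pex ps] := sC.
have [m [mi ma mb]] := glue _ _ _ _ _ _ _ _ _ h hE' f'i fi.
have [ai bex bs] := h.
have sQ := ses_proj mi; set q := proj _ in sQ; have [_ qex qs] := sQ.
have [il ilE] := pair_inl E' E.
have k1 x : p' x = 0 -> (q \o il) x = 0.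
  by move=> /p'ex[n <-]; rewrite /= ilE -ma; apply/qex; eexists.
have k2 x : q x = 0 -> (p \o snd) x = 0.
  by move=> /qex[c <-]; rewrite /= mb; apply/pex; eexists.
have [a1 a1E] := surj_factor p's k1; have [b1 b1E] := surj_factor qs k2.
exists (E' * E)%type, (quot (submod_range m)), m, q; split=> //; first exact: prod_injective.
apply: (ih _ _ _ _ _ a1 b1) tN tC; split.
- apply: lin_inj => y; have [x <-] := p's y; rewrite a1E /= => /qex[c].
  rewrite ilE => mc; have := mb c; rewrite mc /= => /esym /(inj_lin0 fi)/bex[n nc].
  by apply/p'ex; exists n; move: mc; rewrite -nc ma => -[].
- move=> y; have [[e' e] <-] := qs y; rewrite b1E /=; split.
    move=> /pex[c' ce]; have [c cc'] := bs c'.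
    exists (p' (e' - (m c).1)); rewrite a1E /= ilE.
    apply/eqP; rewrite -subr_eq0 -linearB; apply/eqP/qex; exists (- c).
    rewrite linearN [m c]surjective_pairing mb cc' ce.
    by congr pair; rewrite /= ?sub0r // addrAC subrr sub0r.
  move=> [z]; have [x <-] := p's z; rewrite a1E /= ilE => /eqP.
  rewrite -subr_eq0 -linearB => /eqP/qex[c] mE.
  have := mb c; rewrite mE /= sub0r => pe.
  by rewrite -[e]opprK pe -linearN; apply/pex; eexists.
- by move=> y; have [e <-] := ps y; exists (q (0, e)); rewrite b1E.
Qed.

(** If [P] embeds in [E], then [E/M] is an extension of [E/P] by [P/M = N]. *)
Lemma inj_term_shift l (M P N J J' : lmodType S) (a : {linear M -> P})
    (b : {linear P -> N}) :
  ses a b -> inj_term false l.+1 P J -> inj_term false l N J' ->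
  inj_term false l.+1 M (J' * J)%type.
Proof.
move=> [ai bex bs] [E [C [k [p [hE [ki pex ps] _ tC]]]]] tN.
have kai : injective (k \o a) by move=> x y /ki/ai.
have sQ := ses_proj (kai : injective (k \o a : {linear M -> E})).
set q := proj _ in sQ; have [_ qex qs] := sQ.
have k1 x : b x = 0 -> (q \o k) x = 0.
  by move=> /bex[m <-]; apply/qex; exists m.
have k2 x : q x = 0 -> p x = 0.
  by move=> /qex[m <-]; apply/pex; eexists.
have [a1 a1E] := surj_factor bs k1; have [b1 b1E] := surj_factor qs k2.
exists E, (quot (submod_range (k \o a))), (k \o a), q; split=> //.
apply: (inj_term_ext (a := a1) (b := b1)) tN tC; split.
- apply: lin_inj => y; have [x <-] := bs y; rewrite a1E /= => /qex[m /ki <-].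
  by apply/bex; eexists.
- move=> y; have [e <-] := qs y; rewrite b1E; split.
    by move=> /pex[x <-]; exists (b x); rewrite a1E.
  move=> [z]; have [x <-] := bs z; rewrite a1E /= => /eqP.
  rewrite -subr_eq0 -linearB => /eqP/qex[m] /= mE.
  by apply/pex; exists (x - a m); rewrite linearB mE opprB addrC subrK.
- by move=> y; have [e <-] := ps y; exists (q e); rewrite b1E.
Qed.

Lemma dprod_map (T : Type) U V (f : {linear U -> V}) :
  exists h : {linear dprod (fun _ : T => U) -> dprod (fun _ : T => V)},
    forall x i, h x i = f (x i).
Proof.
have [r x y|h hE] := @linear_ex S (dprod (fun _ : T => U)) (dprod (fun _ : T => V))
    (fun x i => f (x i)).
  by apply: dprodP => i; rewrite linearP.
by exists h => x i; rewrite hE.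
Qed.

Lemma inj_term_power (T : Type) l M J : inj_term false l M J ->
  inj_term false l (dprod (fun _ : T => M)) (dprod (fun _ : T => J)).
Proof.
have inj_map U V (f : {linear U -> V}) h : injective f ->
    (forall x i, h x i = f (x i)) ->
    @injective (dprod (fun _ : T => V)) (dprod (fun _ : T => U)) h.
  by move=> fi hE x y hxy; apply: dprodP => i; apply: fi; rewrite -!hE hxy.
elim: l M => [|l ih] M /=.
  move=> [hJ [f [fi _]]]; split; first exact: dprod_injective.
  by have [h hE] := dprod_map T f; exists h; split=> //; apply: inj_map hE.
move=> [E [C [f [p [hE [fi pex ps] _ tC]]]]].
have [f' f'E] := dprod_map T f; have [p' p'E] := dprod_map T p.
exists (dprod (fun _ => E)), (dprod (fun _ => C)), f', p'; split=> //; last exact: ih.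
  exact: dprod_injective.
split; first exact: inj_map f'E.
- move=> y; split.
    move=> py; have ex i : exists x, f x = y i by apply/pex; rewrite -p'E py.
    have [x xE] := choice ex; exists x; apply: dprodP => i; by rewrite f'E.
  move=> [x <-]; apply: dprodP => i; rewrite p'E f'E; apply/pex; by eexists.
- move=> y; have [x xE] := choice (fun i => ps (y i)).
  by exists x; apply: dprodP => i; rewrite p'E.
Qed.
End InjTerm.

Lemma dprod_inj (S : pzRingType) (T : eqType) (V : T -> lmodType S) :
  exists inj : forall i, {linear V i -> dprod V},
    (forall i x, inj i x i = x) /\ forall i j x, i != j -> inj i x j = 0.
Proof.
pose in0 (i : T) (x : V i) : dprod V :=
  @dfwith T (fun j => V j) (fun _ => 0) i x.
have in0_in (i : T) x : in0 i x i = x by exact: dfwith_in.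
have in0_out (i j : T) x : i != j -> in0 i x j = 0 by exact: dfwith_out.
have ex (i : T) : exists g : {linear V i -> dprod V}, g =1 in0 i.
  apply: linear_ex => r x y; apply: dprodP => j.
  rewrite -[RHS]/(r *: in0 i x j + in0 i y j).
  have [<-|ij] := eqVneq i j; first by rewrite !in0_in.
  by rewrite !in0_out // scaler0 addr0.
pose inj i := projT1 (cid (ex i)); have injE i x : inj i x = in0 i x := projT2 (cid (ex i)) x.
exists inj; split=> [i x|i j x]; first by rewrite injE in0_in.
by rewrite injE; exact: in0_out.
Qed.

Lemma dprod_direct_sum (S : pzRingType) (T : finType) (V : T -> lmodType S) :
  exists inj : forall i, {linear V i -> dprod V},
    [/\ is_direct_sum inj, forall i x, inj i x i = x
      & forall x : dprod V, x = \sum_i inj i (x i)].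
Proof.
have [inj [diag off]] := dprod_inj V.
have sum (x : dprod V) : x = \sum_i inj i (x i).
  apply: dprodP => j; rewrite dprod_sum (bigD1 j) //= diag big1 ?addr0 // => i ij.
  exact: off.
exists inj; split=> // N g.
have [r x y|h hE] := @linear_ex S (dprod V) N (fun x => \sum_i g i (x i)).
  rewrite scaler_sumr -big_split; apply: eq_bigr => i _; exact: (linearP (g i) r (x i) (y i)).
exists h; split.
  move=> i x; rewrite hE (bigD1 i) //= diag big1 ?addr0 // => j ji.
  by rewrite off ?linear0 // eq_sym.
move=> h' h'E x; rewrite hE {1}(sum x) linear_sum; apply: eq_bigr => i _; exact: h'E.
Qed.

(** * Injective resolutions of syzygies *)

(** [f] factors through a finite direct sum of modules among [W 0], ..., [W l].
    For [f] the identity of [U] this says that [U] is a summand of such a sum, in a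
    form that is visibly stable under sums and compositions. *)
Definition factors (S : pzRingType) (W : nat -> lmodType S) (l : nat)
    (U V : lmodType S) (f : U -> V) :=
  exists (T : finType) (idx : T -> 'I_l.+1) (a : forall t, {linear U -> W (idx t)})
    (b : forall t, {linear W (idx t) -> V}), forall x, f x = \sum_t b t (a t x).

Section Factors.
Variables (S : pzRingType) (W : nat -> lmodType S).
Implicit Types (U V J : lmodType S).

Lemma factors_comp l U V U' V' (f : U -> V) (c : {linear U' -> U}) (d : {linear V -> V'}) :
  factors W l f -> factors W l (d \o f \o c).
Proof.
move=> [T [idx [a [b fE]]]].
exists T, idx, (fun t => a t \o c), (fun t => d \o b t) => x.
by rewrite /= fE linear_sum.
Qed.

Lemma factors_ext l U V (f g : U -> V) : f =1 g -> factors W l f -> factors W l g.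
Proof. by move=> /funext ->. Qed.

Lemma factors_add l U V (f g : U -> V) :
  factors W l f -> factors W l g -> factors W l (fun x => f x + g x).
Proof.
move=> [T [idx [a [b fE]]]] [T' [idx' [a' [b' gE]]]].
pose ix (t : T + T') := match t with inl t => idx t | inr t => idx' t end.
exists (T + T')%type, ix,
  (fun t => match t return {linear U -> W (ix t)} with inl t => a t | inr t => a' t end),
  (fun t => match t return {linear W (ix t) -> V} with inl t => b t | inr t => b' t end).
by move=> x; rewrite big_sumType /= fE gE.
Qed.

Lemma factors_id_retract l U V : retract U V ->
  factors W l (@id V) -> factors W l (@id U).
Proof. by move=> [s [r rs]] /(factors_comp s r); apply: factors_ext. Qed.

Lemma factors_id_prod l U V : factors W l (@id U) -> factors W l (@id V) ->
  factors W l (@id (U * V)%type).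
Proof.
move=> fU fV; have [il ilE] := pair_inl U V.
have [ir irE] := pair_map (\0 : {linear V -> U}) (@idfun V : {linear V -> V}).
have := factors_add (factors_comp fst il fU) (factors_comp snd ir fV).
apply: factors_ext => -[u v]; rewrite /= ilE irE.
by rewrite -[LHS]/(u + 0, 0 + v) addr0 add0r.
Qed.

Lemma factors_id_power l m : factors W l (@id (dprod (fun _ : 'I_m => W l))).
Proof.
have [inj [_ _ sum]] := dprod_direct_sum (fun _ : 'I_m => W l).
pose pr i := projT1 (cid (@dprod_eval S 'I_m (fun _ => W l) i)).
have prE i x : pr i x = x i := projT2 (cid (@dprod_eval S 'I_m (fun _ => W l) i)) x.
exists 'I_m, (fun _ => ord_max), pr, inj => x.
by rewrite {1}(sum x); apply: eq_bigr => i _; rewrite prE.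
Qed.

Lemma factors_id_mono l U : factors W l (@id U) -> factors W l.+1 (@id U).
Proof.
move=> [T [idx [a [b fE]]]].
by exists T, (fun t => widen_ord (leqnSn _) (idx t)), a, b.
Qed.

Lemma retract_summand U V : retract U V -> iso_direct_summand U V.
Proof.
move=> [s [r rs]].
have hS := submod_range s; pose p : {linear V -> quot hS} := proj hS.
have pk x : p x = 0 -> ((@idfun V) \- (s \o r)) x = 0.
  by move=> /proj_eq0[u <-]; rewrite /= rs subrr.
have [t tE] := surj_factor (@proj_surj _ _ _ hS) pk.
have rt y : r (t y) = 0.
  by have [x <-] := @proj_surj _ _ _ hS y; rewrite tE /= linearB rs subrr.
have pt y : p (t y) = y.
  have [x <-] := @proj_surj _ _ _ hS y; rewrite tE /= linearB.
  have -> : p (s (r x)) = 0 by apply/proj_eq0; eexists.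
  exact: subr0.
have [c x y|f fE] := @linear_ex S (U * quot hS)%type V (fun x => s x.1 + t x.2).
  by rewrite /= !linearP scalerDr addrACA.
exists (quot hS), f; exists (fun v => (r v, p v)) => [[u q]|v].
  rewrite fE /= !linearD rs rt pt addr0; congr pair.
  have -> : p (s u) = 0 by apply/proj_eq0; eexists.
  exact: add0r.
by rewrite fE /= tE /= addrC subrK.
Qed.

Lemma factors_in_Add l U : factors W l (@id U) ->
  exists (D : lmodType S) (inj : forall j : 'I_l.+1, {linear W j -> D}),
    is_direct_sum inj /\ in_Add D U.
Proof.
move=> [T [idx [a [b fE]]]].
have [inj [ds diag _]] := dprod_direct_sum (fun j : 'I_l.+1 => W j).
set D := dprod _ in inj ds diag; exists D, inj; split=> //.
have [inj' [ds' _ _]] := dprod_direct_sum (fun _ : T => D).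
exists T, (dprod (fun _ : T => D)), inj'; split=> //.
apply: retract_summand.
have [s sE] := dprod_pair (fun t => inj (idx t) \o a t).
have [c x y|r rE] := @linear_ex S (dprod (fun _ : T => D)) U
    (fun x => \sum_t b t (x t (idx t))).
  rewrite scaler_sumr -big_split; apply: eq_bigr => t _.
  exact: (linearP (b t) c (x t (idx t)) (y t (idx t))).
exists s, r => x; rewrite rE [RHS]fE; apply: eq_bigr => t _.
by rewrite sE /= diag.
Qed.
End Factors.

(** Splitting off one projective at a time makes both inductions below direct. *)
Fixpoint syzygy (S : pzRingType) (i : nat) (M : lmodType S) : Prop :=
  if i is i'.+1 then
    exists (P N : lmodType S) (f : {linear M -> P}) (g : {linear P -> N}),
      [/\ fingen P, projective P, ses f g & syzygy i' N]
  else True.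

Lemma fingen_surj (S : pzRingType) (M N : lmodType S) (p : {linear M -> N}) :
  surj p -> fingen M -> fingen N.
Proof.
move=> ps [n [v vE]]; exists n, (fun i => p (v i)) => y.
have [x <-] := ps y; have [c ->] := vE x; exists c.
by rewrite linear_sum; apply: eq_bigr => i _; rewrite linearZ.
Qed.

Lemma fingen_power (S : pzRingType) (M : lmodType S) : fingen M ->
  exists (n : nat) (p : {linear dprod (fun _ : 'I_n => S^o) -> M}), surj p.
Proof.
move=> [n [v vE]]; exists n.
have [c x y|p pE] := @linear_ex S (dprod (fun _ : 'I_n => S^o)) M
    (fun x => \sum_i (x i : S) *: v i).
  rewrite scaler_sumr -big_split; apply: eq_bigr => i _ /=.
  by rewrite scalerA -scalerDl.
by exists p => x; have [d ->] := vE x; exists d; rewrite pE.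
Qed.

Lemma Omega_syzygy (S : pzRingType) i (M : lmodType S) :
  Omega_class i.+1 M -> syzygy i.+1 M.
Proof.
elim: i M => [|i ih] M [_ [C [e [d [fC pC [ei ex0] exd sd]]]]].
  exists (C 0%N), (C 1%N), e, (d 0%N); split=> //; [exact: fC|exact: pC|].
  by split=> //; exact: sd.
have sQ := ses_proj ei; set p := proj _ in sQ; have [_ pex ps] := sQ.
have k x : p x = 0 -> d 0%N x = 0 by move=> /pex/ex0.
have [e' e'E] := surj_factor ps k.
exists (C 0%N), (quot (submod_range e)), e, p; split; [exact: fC|exact: pC|done|].
apply: ih; split; first by apply: fingen_surj ps _; exact: fC.
exists (fun j => C j.+1), e', (fun j => d j.+1); split.
- by move=> j ji; exact: fC.
- by move=> j ji; exact: pC.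
- split.
    apply: lin_inj => y; have [x <-] := ps y; rewrite e'E => /ex0 h.
    exact/pex.
  move=> y; apply: iff_trans (exd 0%N isT y) _; split=> [[x <-]|[x <-]].
    by exists (p x).
  by have [z <-] := ps x; exists z.
- by move=> j ji; exact: exd.
- by move=> j ji; apply: sd; rewrite ji.
Qed.

Lemma syzygy_Omega (S : pzRingType) i (M : lmodType S) :
  fingen M -> syzygy i.+1 M -> Omega_class i.+1 M.
Proof.
elim: i M => [|i ih] M hM [P [N [f [g [fP pP [fi fex gs] hN]]]]].
  pose C j : lmodType S := if j is 0%N then P else N.
  split=> //; exists C, f,
    (fun j => match j return {linear C j -> C j.+1} with
              0%N => g | _.+1 => @idfun N end).
  split=> //; [|by case=> [_|j ji]; [exact: pP|]|by case].
  by case=> [|j] _ //=; exact: fingen_surj gs fP.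
have [_ [C [e [d [fC pC [ei ex0] exd sd]]]]] := ih N (fingen_surj gs fP) hN.
pose C' j : lmodType S := if j is j'.+1 then C j' else P.
split=> //; exists C', f,
    (fun j => match j return {linear C' j -> C' j.+1} with
              0%N => e \o g | j'.+1 => d j' end).
split.
- by case=> [|j] //= ji; exact: fC.
- by case=> [_|j ji]; [exact: pP|exact: pC].
- split=> // y; rewrite -fex; split=> [/= /(inj_lin0 ei) //|h].
  by rewrite /= h linear0.
- case=> [|j] ji; last exact: exd.
  move=> y; rewrite ex0; split=> [[x <-]|[x <-]]; last by eexists.
  by have [z <-] := gs x; exists z.
- by case=> [|j] [] // ji; apply: sd; rewrite ji.
Qed.

(** The terms for a finitely generated projective [P] are summands of powers of
    those of [R]; the induction step adds the terms for [P] and for [N], by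
    [inj_term_shift]. *)
Lemma syzygy_inj_term (S : pzRingType) (I : min_inj_res S^o) i (M : lmodType S) l :
  syzygy i M -> (l < i)%N ->
  exists J, inj_term false l M J /\ factors I l (@id J).
Proof.
have projI (P : lmodType S) j : fingen P -> projective P ->
    exists J, inj_term false j P J /\ factors I j (@id J).
  move=> /fingen_power[n [p ps]] pP; have [IP] := min_inj_res_exists P.
  exists (IP j); split; first exact: mir_inj_term.
  have [s sE] := pP _ _ p idfun ps.
  apply: factors_id_retract (factors_id_power _ _ n).
  apply: (@inj_term_retract _ j P (dprod (fun _ : 'I_n => S^o))).
  - by exists s, p.
  - exact: mir_inj_term.
  - by apply: inj_term_power; exact: mir_inj_term.
elim: l i M => [|l ih] [//|i] M /= [P [N [f [g [fP pP sfg hN]]]]] li.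
  have [J [[hJ [k [ki _]]] fJ]] := projI P 0%N fP pP; exists J; split=> //; split=> //.
  by exists (k \o f); split=> // x y /ki; case: sfg => fi _ _; exact: fi.
have [J' [tN fJ']] := ih _ _ hN li.
have [J [tP fJ]] := projI P l.+1 fP pP.
exists (J' * J)%type; split; first exact: inj_term_shift sfg tP tN.
by apply: factors_id_prod fJ; exact: factors_id_mono.
Qed.

Lemma syzygy_R_class (S : pzRingType) i (M : lmodType S) :
  fingen M -> syzygy i M -> R_class i M.
Proof.
move=> fM hM; split=> //.
have [IM] := min_inj_res_exists M; have [I] := min_inj_res_exists S^o.
exists IM, I => l li.
have [J [tM fJ]] := syzygy_inj_term I hM li.
apply: factors_in_Add; apply: factors_id_retract fJ.
apply: (@inj_term_retract _ l M M) tM; first by exists idfun, idfun.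
exact: mir_inj_term.
Qed.

(** * Artin algebras are noetherian on both sides *)

Fixpoint lspan (S : pzRingType) (L : lmodType S) (s : seq L) (x : L) : Prop :=
  if s is v :: s' then exists c : S, lspan s' (x - c *: v) else x = 0.

Definition fg_submod (S : pzRingType) (L : lmodType S) (V : L -> Prop) :=
  exists s : seq L, forall x, V x <-> lspan s x.

Definition noetherian (S : pzRingType) :=
  forall V : S^o -> Prop, is_submodule V -> fg_submod V.

Section Span.
Variables (S : pzRingType) (L : lmodType S).
Implicit Types (s t : seq L) (V W : L -> Prop).

Lemma submod_lspan s : is_submodule (lspan s).
Proof.
elim: s => [|v s ih]; first exact: submod_zero.
split.
- by exists 0; rewrite scale0r subr0; exact: (submod0 ih).
- move=> x y [c hc] [d hd]; exists (c + d).
  by rewrite scalerDl opprD addrACA; exact: (submodD ih).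
- move=> r x [c hc]; exists (r * c).
  by rewrite -scalerA -scalerBr; exact: (submodZ ih).
Qed.

Lemma lspan_le V s : is_submodule V -> (forall x, x \in s -> V x) ->
  forall x, lspan s x -> V x.
Proof.
move=> hV; elim: s => [_ x ->|v s ih h x [c /ih hc]]; first exact: submod0.
rewrite -[x](subrK (c *: v)); apply: (submodD hV).
  by apply: hc => y ys; apply: h; rewrite inE ys orbT.
by apply: (submodZ hV); apply: h; rewrite inE eqxx.
Qed.

Lemma lspan_mem s x : x \in s -> lspan s x.
Proof.
elim: s => [//|v s ih]; rewrite inE => /orP[/eqP ->|/ih h] /=.
  by exists 1; rewrite scale1r subrr; exact: (submod0 (submod_lspan s)).
by exists 0; rewrite scale0r subr0.
Qed.

Lemma lspan_cat s t x y : lspan s x -> lspan t y -> lspan (s ++ t) (x + y).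
Proof.
move=> hx hy; apply: (submodD (submod_lspan _)).
  apply: (lspan_le (submod_lspan _)) hx => z zs.
  by apply: lspan_mem; rewrite mem_cat zs.
apply: (lspan_le (submod_lspan _)) hy => z zs.
by apply: lspan_mem; rewrite mem_cat zs orbT.
Qed.

Lemma fg_submodP V s : is_submodule V -> (forall x, x \in s -> V x) ->
  (forall x, V x -> lspan s x) -> fg_submod V.
Proof. by move=> hV sV Vs; exists s => x; split; [exact: Vs|exact: lspan_le]. Qed.

Lemma submod_meet V W : is_submodule V -> is_submodule W ->
  is_submodule (fun x => V x /\ W x).
Proof.
move=> hV hW; split.
- by split; [exact: (submod0 hV)|exact: (submod0 hW)].
- by move=> x y [? ?] [? ?]; split; [exact: (submodD hV)|exact: (submodD hW)].
- by move=> r x [? ?]; split; [exact: (submodZ hV)|exact: (submodZ hW)].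
Qed.

End Span.

Section Noetherian.
Variables (S : pzRingType) (L : lmodType S).
Implicit Types (s t : seq L) (V W : L -> Prop).

(** [G a x] reads: [x] lifts [a].  A relation rather than a map, since coefficients
    lift to elements only up to a smaller span in [noetherian_fg]. *)
Lemma lspan_lift (L' : lmodType S) V (s : seq L') (G : L' -> L -> Prop) :
  is_submodule V -> G 0 0 ->
  (forall c a a' x x', G a x -> G a' x' -> G (c *: a + a') (c *: x + x')) ->
  (forall a, a \in s -> exists2 x, V x & G a x) ->
  exists t, (forall x, x \in t -> V x) /\
    forall a, lspan s a -> exists2 x, lspan t x & G a x.
Proof.
move=> hV G0 GD; elim: s => [_|v s ih h].
  by exists [::]; split=> // a ->; exists 0.
have [x Vx Gx] : exists2 x, V x & G v x by apply: h; rewrite inE eqxx.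
have [|t [tV tG]] := ih; first by move=> a sa; apply: h; rewrite inE sa orbT.
exists (x :: t); split=> [y|a [c /tG[y ty Gy]]].
  by rewrite inE => /orP[/eqP ->|/tV].
exists (c *: x + y); first by exists c; rewrite addrC addKr.
by rewrite -[a](subrK (c *: v)) addrC; exact: GD.
Qed.

Lemma fg_ext V (L' : lmodType S) (f : {linear L -> L'}) :
  is_submodule V -> fg_submod (fun y => exists2 x, V x & y = f x) ->
  fg_submod (fun x => V x /\ f x = 0) -> fg_submod V.
Proof.
move=> hV [s hs] [t ht].
have [|||u [uV uG]] := @lspan_lift L' V s (fun a x => a = f x) hV.
- by rewrite linear0.
- by move=> c a a' x x' -> ->; rewrite linearP.
- by move=> a /lspan_mem sa; apply/hs.
apply: (@fg_submodP _ _ V (u ++ t)) => // x.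
  by rewrite mem_cat => /orP[/uV //|/lspan_mem xt]; case: ((ht x).2 xt).
move=> Vx; have /uG[y uy fy] : lspan s (f x) by apply/hs; exists x.
rewrite -[x](subrK y) addrC; apply: lspan_cat => //.
apply/ht; split; last by rewrite linearB fy subrr.
by apply: (submodB hV) => //; exact: lspan_le uy.
Qed.

(** Induction on the generators of the ambient span; the coefficients of the first
    one, over the elements of [V], form a left ideal. *)
Lemma noetherian_fg s V : noetherian S -> is_submodule V -> (forall x, V x -> lspan s x) ->
  fg_submod V.
Proof.
move=> nS; elim: s V => [|v s ih] V hV Vs; first by apply: (@fg_submodP _ _ _ [::]).
pose I (r : S^o) := exists2 x, V x & lspan s (x - (r : S) *: v).
have hI : is_submodule I.
  split.
  - by exists 0; [exact: (submod0 hV)|rewrite scale0r subr0; exact: (submod0 (submod_lspan s))].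
  - move=> a b [x Vx hx] [y Vy hy]; exists (x + y); first exact: (submodD hV).
    by rewrite scalerDl opprD addrACA; exact: (submodD (submod_lspan s)).
  - move=> r a [x Vx hx]; exists (r *: x); first exact: (submodZ hV).
    by rewrite -scalerA -scalerBr; exact: (submodZ (submod_lspan s)).
have [rs hrs] := nS I hI.
have [|||u [uV uG]] := @lspan_lift S^o V rs (fun a x => lspan s (x - (a : S) *: v)) hV.
- by rewrite scale0r subr0; exact: (submod0 (submod_lspan s)).
- move=> c a a' x x' h h'; rewrite scalerDl opprD addrACA -scalerA -scalerBr.
  by apply: (submodD (submod_lspan s)) => //; exact: (submodZ (submod_lspan s)).
- by move=> a /lspan_mem sa; apply/hrs.
have [||t ht] := ih (fun x => V x /\ lspan s x).
- by apply: submod_meet => //; exact: submod_lspan.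
- by move=> x [].
apply: (@fg_submodP _ _ V (u ++ t)) => // x.
  by rewrite mem_cat => /orP[/uV //|/lspan_mem xt]; case: ((ht x).2 xt).
move=> Vx; have [c hc] := Vs _ Vx.
have /uG[y uy sy] : lspan rs c by apply/hrs; exists x.
rewrite -[x](subrK y) addrC; apply: lspan_cat => //.
apply/ht; split; first by apply: (submodB hV) => //; exact: lspan_le uy.
have := submodB (submod_lspan s) hc sy.
by rewrite opprB addrA subrK.
Qed.

Lemma lspan_sum (I : Type) (r : seq I) (c : I -> S) (v : I -> L) :
  lspan (map v r) (\sum_(i <- r) c i *: v i).
Proof.
elim: r => [|i r ih] /=; first by rewrite big_nil.
by exists (c i); rewrite big_cons addrC addKr.
Qed.

Lemma fingen_lspan : fingen L -> exists s : seq L, forall x, lspan s x.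
Proof.
move=> [n [v vE]]; exists (map v (index_enum 'I_n)) => x.
by have [c ->] := vE x; exact: lspan_sum.
Qed.
End Noetherian.

Lemma artinian_min (k : comNzRingType) (P : (k^o -> Prop) -> Prop) (V0 : k^o -> Prop) :
  artinian k -> is_submodule V0 -> P V0 ->
  exists V : k^o -> Prop, [/\ is_submodule V, P V &
    forall W : k^o -> Prop, is_submodule W -> P W -> (forall x, W x -> V x) ->
      forall x, V x -> W x].
Proof.
move=> ak hV0 PV0; apply: contrapT => no.
pose T := {V : k^o -> Prop | is_submodule V /\ P V}.
have step (V : T) : exists W : T, (forall x, sval W x -> sval V x) /\
    ~ (forall x, sval V x -> sval W x).
  case: V => V [hV PV] /=; apply: contrapT => no'; apply: no; exists V; split=> //.
  move=> W hW PW WV; apply: contrapT => VW; apply: no'.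
  by exists (exist _ W (conj hW PW)).
have [f hf] := choice step.
pose J n := sval (iter n f (exist _ V0 (conj hV0 PV0))).
have [n|n x /(hf _).1 //|n hn] := ak J.
  by rewrite /J; case: (iter _ _ _) => V [].
have [_] := hf (iter n f (exist _ V0 (conj hV0 PV0))); apply => x Vx.
by apply/(hn n.+1 (leqnSn n)).
Qed.

(** Take a minimal ideal [N] that is not finitely generated.  Multiplication by a
    scalar [a] has kernel [N] or image [N] on it, and in the second case [a] is
    invertible on [N] because the powers of [a] stabilize; so [N] behaves like a
    vector space, where the complement of a line is a proper submodule, hence
    finitely generated. *)
Lemma artinian_noetherian (k : comNzRingType) : artinian k -> noetherian k.
Proof.
move=> ak V0 hV0; apply: contrapT => nfg0.
have [N [hN nfg Nmin]] := @artinian_min k (fun V => ~ fg_submod V) V0 ak hV0 nfg0.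
have proper W : is_submodule W -> (forall x, W x -> N x) ->
    fg_submod W \/ (forall x, N x -> W x).
  by move=> hW WN; have [|nW] := pselect (fg_submod W); [left|right; exact: Nmin].
have dich (a : k) : (forall x, N x -> a * x = 0) \/ forall x, N x -> exists2 y, N y & x = a * y.
  have [c x y|m mE] := @linear_ex k k^o k^o (fun x => a * x).
    by rewrite mulrDr; congr (_ + _); rewrite -[LHS]/(a * (c * x)) mulrCA.
  have h1 : is_submodule (fun x : k^o => N x /\ m x = 0).
    by apply: submod_meet => //; exact: submod_ker.
  have h2 := submod_im m hN.
  have [|fK|hK] := proper _ h1; first by move=> x [].
    have [|fI|hI] := proper _ h2; first by move=> _ [x Nx ->]; rewrite mE; exact: (submodZ hN a Nx).
      by case: nfg; exact: fg_ext fI fK.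
    by right=> x /hI[y Ny ->]; exists y; rewrite // mE.
  by left=> x /hK[_]; rewrite mE.
have inv (a : k) : (forall x, N x -> a * x = 0) \/ exists b : k, forall x, N x -> (b * a) * x = x.
  have [?|onto] := dich a; first by left.
  right; pose J n (x : k^o) := exists r, x = r * a ^+ n :> k.
  have [n|n x [r ->]|n hn] := ak J.
  - split; first by exists 0; rewrite mul0r.
      by move=> x y [r ->] [s ->]; exists (r + s); rewrite mulrDl.
    by move=> r x [s ->]; exists (r * s); rewrite -mulrA.
  - by exists (r * a); rewrite exprS mulrA.
  have [b bE] : J n.+1 (a ^+ n) by apply/(hn n.+1 (leqnSn n)); exists 1; rewrite mul1r.
  have onton m x : N x -> exists2 y, N y & x = a ^+ m * y.
    elim: m x => [|m ih] x Nx; first by exists x; rewrite // expr0 mul1r.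
    have [y Ny ->] := onto x Nx; have [z Nz ->] := ih y Ny.
    by exists z; rewrite // mulrA -exprS.
  exists b => x /(onton n)[y Ny ->].
  by rewrite mulrA -[b * a * _]mulrA -exprS -bE.
have [x [Nx x0]] : exists x, N x /\ x <> 0.
  apply: contrapT => no; apply: nfg; apply: (@fg_submodP _ _ N [::]) => // x Nx.
  by apply: contrapT => x0; apply: no; exists x.
pose C (y : k^o) := exists r, y = r *: (x : k^o).
have [|V [hV _ VC Vmax]] := max_meet0 (submod_zero k^o) (C := C); first by move=> y -> _.
have split y : N y -> exists c : k, V (y - c * x).
  move=> Ny; apply: contrapT => no; case: (no); exists 0; rewrite mul0r subr0.
  apply: (Vmax (fun z => exists (b : k) (v : k^o), V v /\ z = v + b *: (y : k^o))).
  - split.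
    + by exists 0, 0; split; [exact: (submod0 hV)|rewrite scale0r addr0].
    + move=> _ _ [b [v [Vv ->]]] [b' [v' [Vv' ->]]]; exists (b + b'), (v + v').
      by split; [exact: (submodD hV)|rewrite scalerDl addrACA].
    + move=> r _ [b [v [Vv ->]]]; exists (r * b), (r *: v).
      by split; [exact: (submodZ hV)|rewrite scalerDr scalerA].
  - by move=> z Vz; exists 0, z; rewrite scale0r addr0.
  - move=> _ [b [v [Vv ->]]] [c h].
    have [by0|[d bd]] := inv b.
      have b0 : b *: (y : k^o) = 0 by exact: by0.
      by move: h; rewrite b0 addr0 => h; apply: VC => //; exists c.
    case: no; exists (d * c).
    have -> : y - d * c * x = - (d *: v) :> k^o; last by apply/(submodN hV)/(submodZ hV).
    have vE : v = c * x - b * y by apply/eqP; rewrite -subr_eq opprK; apply/eqP.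
    by rewrite vE -[_ *: _]/(d * _) mulrBr !mulrA bd // opprB.
  - by exists 1, 0; split; [exact: (submod0 hV)|rewrite add0r scale1r].
have [||[t ht]|NV] := proper (fun y => N y /\ V y).
- exact: submod_meet.
- by move=> y [].
- apply: nfg; apply: (@fg_submodP _ _ N (x :: t)) => // y.
    by rewrite inE => /orP[/eqP -> //|/lspan_mem xt]; case: ((ht y).2 xt).
  move=> Ny; have [c hc] := split y Ny; exists c; apply/ht; split=> //.
  by apply: (submodB hN) => //; exact: (submodZ hN).
- apply: x0; apply: VC; first by case: (NV x Nx).
  by exists 1; rewrite scale1r.
Qed.

(** Left and right ideals of [R] are submodules of a finitely generated module over
    the noetherian ring [k]. *)
Lemma artin_noetherian (k : comNzRingType) (R : algType k) :
  artin_algebra R -> noetherian R /\ noetherian R^c.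
Proof.
move=> [/artinian_noetherian nk /fingen_lspan[s hs]].
split=> V hV.
- have hVk : @is_submodule _ (R : lmodType k) V.
    split; [exact: (submod0 hV)|exact: (submodD hV)|].
    by move=> c x Vx; rewrite -[x]mul1r scalerAl; exact: (submodZ hV (c *: 1) Vx).
  have [t ht] := noetherian_fg nk hVk (fun x _ => hs x).
  apply: (@fg_submodP _ _ V t) => // [x xt|x /ht]; first exact/ht/lspan_mem.
  elim: t x {ht} => [|v t ih] x //= [c hc]; exists (c *: 1).
  suff <- : c *: v = (c *: 1 : R) *: (v : R^o) by exact: ih.
  by rewrite -[RHS]/((c *: 1) * v) -scalerAl mul1r.
- have hVk : @is_submodule _ (R : lmodType k) V.
    split; [exact: (submod0 hV)|exact: (submodD hV)|].
    by move=> c x Vx; rewrite -[x]mulr1 scalerAr; exact: (submodZ hV (c *: 1 : R) Vx).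
  have [t ht] := noetherian_fg nk hVk (fun x _ => hs x).
  apply: (@fg_submodP _ _ V t) => // [x xt|x /ht]; first exact/ht/lspan_mem.
  elim: t x {ht} => [|v t ih] x //= [c hc]; exists (c *: 1 : R).
  suff <- : c *: v = (c *: 1 : R^c) *: (v : (R^c)^o) by exact: ih.
  by rewrite -[RHS]/(v * (c *: 1) : R) -scalerAr mulr1.
Qed.

Lemma noetherian_mx (S : pzRingType) p (V : 'rV[S]_p -> Prop) :
  noetherian S -> is_submodule V ->
  exists m (B : 'M[S]_(m, p)), forall v, V v <-> exists w, v = w *m B.
Proof.
move=> nS hV.
have [|s hs] := @noetherian_fg _ _ [seq delta_mx 0 j | j <- index_enum 'I_p] V nS hV.
  by move=> v _; rewrite [v]matrix_sum_delta big_ord1; exact: lspan_sum.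
suff [m [B hB]] : exists m (B : 'M[S]_(m, p)), forall v, lspan s v <-> exists w, v = w *m B.
  by exists m, B => v; rewrite hs.
elim: s {hs} => [|v s [m [B hB]]].
  exists 0%N, 0 => v; split=> [->|[w ->]]; last by rewrite /= mulmx0.
  by exists 0; rewrite mulmx0.
exists (1 + m)%N, (col_mx v B) => x; split=> [[c /hB[w wE]]|[w ->]].
  exists (row_mx c%:M w); rewrite mul_row_col mul_scalar_mx -wE addrC subrK //.
exists (lsubmx w 0 0); apply/hB; exists (rsubmx w).
rewrite -{1}[w]hsubmxK mul_row_col [lsubmx w in X in X - _]mx11_scalar mul_scalar_mx.
by rewrite addrC addKr.
Qed.

(** * Matrices acting on tuples of module elements *)

(** Tuples of elements of [M] are maps from a free module to [M]; a matrix acts on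
    them by precomposition, which is additive but in general not linear. *)
Definition power (S : pzRingType) (M : lmodType S) (q : nat) : lmodType S :=
  dprod (fun _ : 'I_q => M).

Definition act (S : pzRingType) (M : lmodType S) p q (B : 'M[S]_(p, q))
  (x : power M q) : power M p := fun i => \sum_j B i j *: x j.

Definition tmap (S : pzRingType) (U V : lmodType S) (f : {linear U -> V}) q
  (x : power U q) : power V q := fun i => f (x i).

Definition row_exact (S : pzRingType) p q r (B : 'M[S]_(p, q)) (C : 'M[S]_(q, r)) :=
  forall v : 'rV_q, v *m C = 0 <-> exists w, v = w *m B.

Lemma row_exact_comp (S : pzRingType) p q r (B : 'M[S]_(p, q)) (C : 'M[S]_(q, r)) :
  row_exact B C -> B *m C = 0.
Proof.
move=> BC; apply/row_matrixP => i; rewrite row0 row_mul; apply/BC.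
by exists (delta_mx 0 i); rewrite -rowE.
Qed.

Lemma submod_row_space (S : pzRingType) p q (B : 'M[S]_(p, q)) :
  is_submodule (fun v : 'rV_q => exists w, v = w *m B).
Proof.
split; first by exists 0; rewrite mul0mx.
- by move=> _ _ [w ->] [w' ->]; exists (w + w'); rewrite mulmxDl.
- by move=> r _ [w ->]; exists (r *: w); rewrite -scalemxAl.
Qed.

(** The transpose, as a matrix over the converse ring; this is how matrices over
    [S] act on right [S]-modules. *)
Definition op_mx (S : pzRingType) p q (Y : 'M[S]_(p, q)) : 'M[S^c]_(q, p) := Y^T.

Lemma op_mxM (S : pzRingType) p q r (Y : 'M[S]_(p, q)) (Z : 'M[S]_(q, r)) :
  op_mx (Y *m Z) = op_mx Z *m op_mx Y.
Proof. by rewrite /op_mx -trmx_mul_rev. Qed.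

Lemma op_mx0 (S : pzRingType) p q : op_mx (0 : 'M[S]_(p, q)) = 0.
Proof. exact: trmx0. Qed.

Lemma op_mxN (S : pzRingType) p q (Y : 'M[S]_(p, q)) : op_mx (- Y) = - op_mx Y.
Proof. by apply/matrixP => i j; rewrite !mxE. Qed.

Lemma op_mx_inj0 (S : pzRingType) p q (Y : 'M[S]_(p, q)) : op_mx Y = 0 -> Y = 0.
Proof. by move=> h; apply: trmx_inj; rewrite trmx0. Qed.

Section Act.
Variables (S : pzRingType).
Implicit Types (M U V E : lmodType S).

Lemma actB M p q (B : 'M[S]_(p, q)) (x y : power M q) :
  act B (x - y) = act B x - act B y.
Proof.
apply: dprodP => i; rewrite -[RHS]/(act B x i - act B y i) /act -sumrB.
by apply: eq_bigr => j _; exact: scalerBr.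
Qed.

Lemma act0r M p q (B : 'M[S]_(p, q)) : act B (0 : power M q) = 0.
Proof. by rewrite -(subrr 0) actB subrr. Qed.

Lemma actN M p q (B : 'M[S]_(p, q)) (x : power M q) : act B (- x) = - act B x.
Proof. by rewrite -sub0r actB act0r sub0r. Qed.

Lemma actD M p q (B : 'M[S]_(p, q)) (x y : power M q) :
  act B (x + y) = act B x + act B y.
Proof. by rewrite -{1}[y]opprK actB actN opprK. Qed.

Lemma act_mul M p q r (B : 'M[S]_(p, q)) (C : 'M[S]_(q, r)) (x : power M r) :
  act (B *m C) x = act B (act C x).
Proof.
apply: dprodP => i; rewrite /act.
transitivity (\sum_j \sum_k (B i k * C k j) *: x j).
  by apply: eq_bigr => j _; rewrite mxE scaler_suml.
rewrite exchange_big; apply: eq_bigr => k _; rewrite scaler_sumr.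
by apply: eq_bigr => j _; rewrite scalerA.
Qed.

Lemma act0l M p q (x : power M q) : act (0 : 'M[S]_(p, q)) x = 0.
Proof. by apply: dprodP => i; rewrite /act big1 // => j _; rewrite mxE scale0r. Qed.

Lemma actNl M p q (B : 'M[S]_(p, q)) (x : power M q) : act (- B) x = - act B x.
Proof.
apply: dprodP => i; rewrite -[RHS]/(- act B x i) /act -sumrN.
by apply: eq_bigr => j _; rewrite mxE scaleNr.
Qed.

Lemma actDl M p q (B C : 'M[S]_(p, q)) (x : power M q) :
  act (B + C) x = act B x + act C x.
Proof.
apply: dprodP => i; rewrite -[RHS]/(act B x i + act C x i) /act -big_split.
by apply: eq_bigr => j _; rewrite mxE scalerDl.
Qed.

Lemma act1 M q (x : power M q) : act 1%:M x = x.
Proof.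
apply: dprodP => i; rewrite /act (bigD1 i) //= big1 => [|j ji].
  by rewrite mxE eqxx scale1r addr0.
by rewrite mxE eq_sym (negbTE ji) scale0r.
Qed.

Lemma act_row M p q (B : 'M[S]_(p, q)) (x : power M q) i :
  act (row i B) x 0 = act B x i.
Proof. by apply: eq_bigr => j _; rewrite mxE. Qed.

Lemma act_delta M q (x : power M q) i : act (delta_mx 0 i : 'rV_q) x 0 = x i.
Proof. by rewrite -row1 act_row act1. Qed.

Lemma tmap_act U V (f : {linear U -> V}) p q (B : 'M[S]_(p, q)) (x : power U q) :
  tmap f (act B x) = act B (tmap f x).
Proof.
apply: dprodP => i; rewrite /tmap linear_sum; apply: eq_bigr => j _.
by rewrite linearZ.
Qed.

Lemma tmapB U V (f : {linear U -> V}) q (x y : power U q) :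
  tmap f (x - y) = tmap f x - tmap f y.
Proof. by apply: dprodP => i; exact: linearB. Qed.

Lemma lin_act U q (x : power U q) :
  exists h : {linear 'rV[S]_q -> U}, forall v, h v = act v x 0.
Proof.
have [c v w|h hE] := @linear_ex S 'rV[S]_q U (fun v => act v x 0); last by exists h.
rewrite actDl -[LHS]/(act (c *: v) x 0 + act w x 0); congr (_ + _).
by rewrite scaler_sumr; apply: eq_bigr => j _; rewrite mxE scalerA.
Qed.

(** A functional on row vectors that kills the kernel of [B] factors through the
    image of [B], from where it extends by injectivity. *)
Lemma injective_act E p q (B : 'M[S]_(p, q)) (e : power E p) :
  injective_module E -> (forall v : 'rV_p, v *m B = 0 -> act v e 0 = 0) ->
  exists g : power E q, e = act B g.
Proof.
move=> hE Be; have [l lE] := lin_act e.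
have [h hh] : exists h : {linear 'rV[S]_q -> E}, forall v : 'rV_p, h (v *m B) = l v.
  have [c v w|f fE] := @linear_ex S 'rV[S]_p 'rV[S]_q (mulmxr B).
    by rewrite linearP.
  have [v|h hE'] := inj_factor (f := f) (g := l) hE; first by rewrite fE lE => /Be.
  by exists h => v; rewrite -hE' fE.
exists (fun j => h (delta_mx 0 j)); apply: dprodP => i.
rewrite -[LHS]act_delta -lE -hh -rowE [row i B]matrix_sum_delta big_ord1 linear_sum.
by apply: eq_bigr => j _; rewrite linearZ /= mxE.
Qed.

Lemma injective_exact E p q r (B : 'M[S]_(p, q)) (C : 'M[S]_(q, r)) (e : power E q) :
  injective_module E -> row_exact B C -> act B e = 0 -> exists g : power E r, e = act C g.
Proof.
move=> hE BC Be; apply: injective_act hE _ => v /BC[w ->].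
by rewrite act_mul Be act0r.
Qed.
End Act.

(** * Vanishing of Ext by matrices *)

(** For consecutive matrices [B] and [C] of a free resolution this is the vanishing of
    Ext in that degree with values in [P/K].  Cocycles and coboundaries lift from
    [P/K] to [P] since the resolution is free, so the quotient is not formed. *)
Definition ext0 (S : pzRingType) p q r (B : 'M[S]_(p, q)) (C : 'M[S]_(q, r))
    (P : lmodType S) (K : P -> Prop) :=
  forall x : power P q, (forall i, K (act B x i)) ->
    exists y : power P r, forall i, K ((x - act C y) i).

Section Shift.
Variables (S : pzRingType) (P0 P1 : lmodType S) (g : {linear P0 -> P1}).
Variables (o p q r : nat) (A : 'M[S]_(o, p)) (B : 'M[S]_(p, q)) (C : 'M[S]_(q, r)).
Variables (K0 : P0 -> Prop) (K1 : P1 -> Prop).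
Hypotheses (AB : A *m B = 0).
Hypotheses (hK0 : forall x, K0 x <-> g x = 0) (hK1 : forall y, K1 y <-> exists x, g x = y).

(** Dimension shifting along [0 -> P0/K0 -> P1 -> P1/K1 -> 0], in both directions. *)
Lemma ext0_up : ext0 B C (fun y : P1 => y = 0) -> ext0 A B K0 -> ext0 B C K1.
Proof.
move=> h1 h0 x Kx; have [f fE] := choice (fun i => (hK1 (act B x i)).1 (Kx i)).
have fE' : tmap g (f : power P0 p) = act B x by apply: dprodP.
have [|w hw] := h0 f.
  move=> i; apply/hK0; rewrite -[LHS]/(tmap g _ i) tmap_act fE' -act_mul AB act0l.
  by [].
have [|y hy] := h1 (x - tmap g w).
  move=> i; rewrite actB -tmap_act -fE' -tmapB; exact/hK0.
exists y => i; apply/hK1; exists (w i).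
have := hy i; rewrite -[LHS]/(x i - g (w i) - act C y i) addrAC => /eqP.
by rewrite subr_eq0 => /eqP <-.
Qed.

Lemma ext0_down : B *m C = 0 ->
  ext0 B C K1 -> ext0 A B (fun y : P1 => y = 0) -> ext0 A B K0.
Proof.
move=> BC h1 h0 x Kx.
have [|y hy] := h0 (tmap g x).
  by move=> i; rewrite -tmap_act; exact/hK0.
have yE : tmap g x = act B y by apply/eqP; rewrite -subr_eq0; apply/eqP/dprodP.
have [|z hz] := h1 y.
  by move=> i; apply/hK1; exists (x i); rewrite -yE.
have [w wE] := choice (fun i => (hK1 _).1 (hz i)).
exists w => i; apply/hK0; rewrite -[LHS]/(tmap g (x - act B w) i) tmapB tmap_act.
have -> : tmap g (w : power P0 q) = y - act C z by apply: dprodP.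
by rewrite yE actB -act_mul BC act0l subr0 subrr.
Qed.
End Shift.

(** * Flat modules and vanishing of Tor *)

Section Tensor.
Variables (S : pzRingType) (F : lmodType S^c) (V : lmodType S).
Variables (p m : nat) (B : 'M[S]_(m, p)) (pi : {linear 'rV[S]_p -> V}).
Hypotheses (pis : surj pi) (piB : forall v, pi v = 0 <-> exists w, v = w *m B).

Let Bt : 'M[S^c]_(p, m) := op_mx B.

Definition tensor_rel (x : zmodule (power F p)) := exists f : power F m, act Bt f = x.
Lemma tensor_rel_sub : is_submodule tensor_rel.
Proof.
have h0 : tensor_rel 0 by exists 0; rewrite act0r.
have hD x y : tensor_rel x -> tensor_rel y -> tensor_rel (x + y).
  by move=> [f <-] [g <-]; exists (f + g); rewrite actD.
have hN x : tensor_rel x -> tensor_rel (- x).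
  by move=> [f <-]; exists (- f); rewrite actN.
have hM n x : tensor_rel x -> tensor_rel (x *+ n).
  by move=> hx; elim: n => [|n ih]; rewrite ?mulr0n // mulrS; exact: hD.
split=> // -[n|n] x hx; rewrite scalezrE; first by rewrite -pmulrn; exact: hM.
by rewrite NegzE mulrNz -pmulrn; apply/hN/hM.
Qed.

Definition tensor : zmodType := quot tensor_rel_sub.
Definition to_tensor : {additive power F p -> tensor} := proj tensor_rel_sub.

Lemma to_tensor0 x : to_tensor x = 0 <-> exists f : power F m, act Bt f = x.
Proof. exact: (proj_eq0 tensor_rel_sub). Qed.

Definition outer (x : F) (v : 'rV[S]_p) : power F p := fun i => (v 0 i : S^c) *: x.

(** By right exactness [F (x) V] is the cokernel of [F^m -> F^p] when [V] is the
    cokernel of [B]; [outer x v] is the image of [x (x) v] in [F^p]. *)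
Lemma tensor_exists : exists t : F -> V -> tensor,
  is_tensor t /\ forall x v, t x (pi v) = to_tensor (outer x v).
Proof.
have [sec secE] := choice pis.
have outerB x v w : outer x (v - w) = outer x v - outer x w.
  apply: dprodP => i; rewrite -[RHS]/(outer x v i - outer x w i) /outer -scalerBl.
  by congr (_ *: _); rewrite !mxE.
have outer0 x : outer x 0 = 0 by rewrite -(subrr 0) outerB subrr.
have outerD x v w : outer x (v + w) = outer x v + outer x w.
  by rewrite -{1}[w]opprK outerB -[- w]sub0r outerB outer0 sub0r opprK.
have outer_ker x v : pi v = 0 -> to_tensor (outer x v) = 0.
  move=> /piB[w ->]; apply/to_tensor0; exists (fun l => (w 0 l : S^c) *: x).
  apply: dprodP => i; rewrite /act /outer mxE (scaler_suml (R := S^c)).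
  by apply: eq_bigr => l _; rewrite scalerA !mxE.
pose t x a := to_tensor (outer x (sec a)).
have tE x v : t x (pi v) = to_tensor (outer x v).
  apply/eqP; rewrite -subr_eq0 -raddfB -outerB; apply/eqP/outer_ker.
  by rewrite linearB secE subrr.
exists t; split=> //.
have e_act (v : 'rV[S]_p) : v = \sum_i v 0 i *: delta_mx 0 i.
  by rewrite {1}[v]matrix_sum_delta big_ord1.
have tb : balanced t.
  split.
  - move=> x y a; rewrite /t -raddfD; congr (to_tensor _); apply: dprodP => i.
    exact: scalerDr.
  - move=> x a a'; have [v <-] := pis a; have [v' <-] := pis a'.
    by rewrite -linearD !tE outerD raddfD.
  - move=> x r a; have [v <-] := pis a; rewrite -linearZ !tE; congr (to_tensor _).
    by apply: dprodP => i; rewrite /outer scalerA; congr (_ *: _); rewrite mxE.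
split=> // G b [bD1 bD2 bZ].
have b0 x : b x 0 = 0 by apply: (addrI (b x 0)); rewrite -bD2 !addr0.
have b01 a : b 0 a = 0 by apply: (addrI (b 0 a)); rewrite -bD1 !addr0.
have bsum x (I : finType) (f : I -> V) : b x (\sum_i f i) = \sum_i b x (f i).
  by apply: (big_morph (b x)) => //; exact: bD2.
have bsum1 a (I : finType) (f : I -> F) : b (\sum_i f i) a = \sum_i b (f i) a.
  by apply: (big_morph (b^~ a)) => // u u'; exact: bD1.
pose A i := pi (delta_mx 0 i).
pose h0 (e : power F p) := \sum_i b (e i) (A i).
have h0D e e' : h0 (e - e') = h0 e - h0 e'.
  rewrite /h0 -sumrB; apply: eq_bigr => i _.
  rewrite -[(e - e') i]/(e i - e' i); apply/eqP; rewrite eq_sym subr_eq -bD1 subrK.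
  exact: eqxx.
have h0_out x v : h0 (outer x v) = b x (pi v).
  rewrite {2}(e_act v) linear_sum bsum; apply: eq_bigr => i _.
  by rewrite /outer bZ linearZ.
have h0_rel e : to_tensor e = 0 -> h0 e = 0.
  move=> /to_tensor0[f <-]; rewrite /h0 /act.
  transitivity (\sum_l \sum_i b (f l) (B l i *: A i)).
    rewrite exchange_big; apply: eq_bigr => i _; rewrite bsum1.
    by apply: eq_bigr => l _; rewrite bZ mxE.
  rewrite big1 // => l _; rewrite -bsum.
  have -> : \sum_i B l i *: A i = pi (row l B).
    rewrite [in RHS](e_act (row l B)) linear_sum; apply: eq_bigr => i _.
    by rewrite linearZ /= mxE.
  have -> : pi (row l B) = 0 by apply/piB; exists (delta_mx 0 l); rewrite -rowE.
  exact: b0.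
have [ts tsE] := choice (@proj_surj _ _ _ tensor_rel_sub).
pose h (q : tensor) := h0 (ts q).
have hE e : h (to_tensor e) = h0 e.
  apply/eqP; rewrite -subr_eq0 -h0D; apply/eqP/h0_rel.
  by rewrite raddfB [X in X - _]tsE subrr.
have hadd : zmod_morphism h.
  move=> x y; rewrite -(tsE x) -(tsE y) -[proj _ (ts x)]/(to_tensor _).
  by rewrite -[proj _ (ts y)]/(to_tensor _) -raddfB !hE h0D.
pose hm := GRing.isZmodMorphism.Build tensor G h hadd.
pose ha : {additive tensor -> G} := HB.pack h hm.
exists ha; split.
  by move=> x a; have [v <-] := pis a; rewrite tE -[LHS]/(h _) hE h0_out.
move=> h' h'E q; have [e <-] := @proj_surj _ _ _ tensor_rel_sub q.
rewrite -[RHS]/(h (to_tensor e)) hE -[proj _ e]/(to_tensor e).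
have eE : e = \sum_i outer (e i) (delta_mx 0 i) :> power F p.
  apply: dprodP => j; rewrite dprod_sum (bigD1 j) //= big1 => [|i ij].
    by rewrite /outer mxE !eqxx scale1r addr0.
  by rewrite /outer mxE eqxx eq_sym (negbTE ij) scale0r.
rewrite {1}eE raddf_sum raddf_sum; apply: eq_bigr => i _.
by rewrite -tE h'E.
Qed.
End Tensor.

(** The equational criterion: flatness applied to the inclusion of the row space of
    [A] in the free module, whose tensor products are both presented by
    [tensor_exists]. *)
Lemma flat_exact (S : pzRingType) (F : lmodType S^c) m p q (B : 'M[S]_(m, p))
    (A : 'M[S]_(p, q)) (e : power F p) :
  flat F -> row_exact B A -> act (op_mx A) e = 0 ->
  exists f : power F m, e = act (op_mx B) f.
Proof.
move=> flatF BA Ae.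
have [c v w|a aE] := @linear_ex S 'rV[S]_p 'rV[S]_q (mulmxr A); first by rewrite linearP.
pose V : lmodType S := quot (submod_ker a); pose pi : {linear 'rV_p -> V} := proj _.
have pis : surj pi := @proj_surj _ _ _ (submod_ker a).
have piB v : pi v = 0 <-> exists w, v = w *m B.
  by rewrite (proj_eq0 (submod_ker a)) aE; exact: BA.
have [u uE] := surj_factor (g := a) pis (fun x => (proj_eq0 (submod_ker a) x).1).
have ui : injective u.
  apply: lin_inj => y; have [v <-] := pis y; rewrite uE => av.
  exact/(proj_eq0 (submod_ker a)).
have ids : surj (@idfun 'rV[S]_q) by move=> v; exists v.
have idB v : @idfun 'rV[S]_q v = 0 <-> exists w, v = w *m (0 : 'M[S]_(0, q)).
  by split=> [/= ->|[w ->]]; [exists 0|]; rewrite mulmx0.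
have [tA [tenA tAE]] := tensor_exists F pis piB.
have [tB [tenB tBE]] := tensor_exists F ids idB.
have [[tB1 tB2 tBZ] _] := tenB.
have [|h [hE _]] := tenA.2 _ (fun x y => tB x (u y)).
  split=> [x y y0|x y y'|x r y]; first exact: tB1.
    by rewrite linearD; exact: tB2.
  by rewrite tBZ linearZ.
have hi := flatF _ _ u ui _ _ _ _ tenA tenB h hE.
have outE r (x : power F r) : x = \sum_i outer (x i) (delta_mx 0 i) :> power F r.
  apply: dprodP => j; rewrite dprod_sum (bigD1 j) //= big1 => [|i ij].
    by rewrite /outer mxE !eqxx scale1r addr0.
  by rewrite /outer mxE eqxx eq_sym (negbTE ij) scale0r.
suff /hi/to_tensor0[f fE] : h (to_tensor F B e) = h 0 by exists f.
rewrite raddf0 (outE _ e) !raddf_sum.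
transitivity (to_tensor F (0 : 'M[S]_(0, q)) (act (op_mx A) e)); last by rewrite Ae raddf0.
transitivity (\sum_i to_tensor F (0 : 'M[S]_(0, q)) (outer (e i) (row i A))).
  apply: eq_bigr => i _.
  by rewrite -tAE hE uE aE -tBE /= -rowE.
rewrite -raddf_sum; congr (to_tensor _ _ _); apply: dprodP => j.
by rewrite dprod_sum /act; apply: eq_bigr => i _; rewrite /outer !mxE.
Qed.

(** The vanishing of [Tor_(q+1)(E, X)] for [q + 1 > d], where the matrices [C] resolve
    [X].  The induction replaces [E] by the kernel of the first map of its flat
    resolution; that kernel is only met through the map [eps] onto it. *)
Lemma flat_dim_tor (S : pzRingType) (c : nat -> nat) (C : forall t, 'M[S]_(c t.+1, c t)) :
  (forall t, row_exact (C t.+1) (C t)) ->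
  forall (E : lmodType S^c) (d q : nat) (e : power E (c q.+1)),
  fd_le E d -> (d <= q)%N ->
  act (op_mx (C q)) e = 0 ->
  exists f : power E (c q.+2), e = act (op_mx (C q.+1)) f.
Proof.
move=> hC.
have gen d : forall (F : nat -> lmodType S^c) (E : lmodType S^c) (eps : {linear F 0%N -> E})
   (p : forall j, {linear F j.+1 -> F j}) q (z : power (F 0%N) (c q.+1)),
   (forall j, flat (F j)) -> exact (p 0%N) eps -> (forall j, exact (p j.+1) (p j)) ->
   (forall j, (d < j)%N -> forall x : F j, x = 0) -> (d <= q)%N ->
   act (op_mx (C q)) (tmap eps z) = 0 ->
   exists w : power (F 0%N) (c q.+2),
     tmap eps z = tmap eps (act (op_mx (C q.+1)) w).
  elim: d => [|d ih] F E eps p q z fF ex0 ex F0 dq Cz.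
    have [w wE] : exists w : power (F 0%N) (c q.+2),
        z = act (op_mx (C q.+1)) w; last by exists w; rewrite -wE.
      apply: flat_exact (fF 0%N) (hC q) _; apply: dprodP => i.
      have /ex0[x <-] : eps (act (op_mx (C q)) z i) = 0.
        by rewrite -[LHS]/(tmap eps _ i) tmap_act Cz.
      by rewrite (F0 1%N isT x) linear0.
  case: q dq z Cz => // q dq z Cz.
  have ex_y i : exists y, p 0%N y = act (op_mx (C q.+1)) z i.
    by apply/ex0; rewrite -[LHS]/(tmap eps _ i) tmap_act Cz.
  have [y yE] := choice ex_y.
  have yE' : tmap (p 0%N) (y : power (F 1%N) _) = act (op_mx (C q.+1)) z.
    by apply: dprodP.
  have CC : (op_mx (C q)) *m (op_mx (C q.+1)) = 0.
    have CC0 : C q.+1 *m C q = 0 by exact/row_exact_comp.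
    by rewrite -trmx_mul_rev CC0 trmx0.
  have [|||||//|w wE] := ih (fun j => F j.+1) (F 0%N) (p 0%N) (fun j => p j.+1) q y.
  - by move=> j; exact: fF.
  - exact: ex.
  - by move=> j; exact: ex.
  - by move=> j dj; exact: F0.
  - by [].
  - by rewrite yE' -act_mul CC act0l.
  have [w' w'E] : exists w' : power (F 0%N) (c q.+3),
      z - tmap (p 0%N) w = act (op_mx (C q.+2)) w'.
    apply: flat_exact (fF 0%N) (hC q.+1) _.
    by rewrite actB -tmap_act -wE yE' subrr.
  exists w'; rewrite -w'E tmapB -[LHS]subr0; congr (_ - _); apply: dprodP => i.
  by apply/esym/ex0; eexists.
move=> E d q e [F [eps [p [fF es ex0 ex F0]]]] dq Ce.
have [z zE] := choice es.
have ze : tmap eps ((fun i => z (e i)) : power (F 0%N) _) = e by apply: dprodP => i; exact: zE.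
have [|w wE] := gen d F E eps p q (fun i => z (e i)) fF ex0 ex F0 dq; first by rewrite ze.
by exists (tmap eps w); rewrite -tmap_act -wE ze.
Qed.

(** * Ext along free resolutions by matrices *)

(** Dimensions of a sequence of free modules with one of rank [p] put in front. *)
Definition scons (p : nat) (a : nat -> nat) (t : nat) : nat :=
  if t is t'.+1 then a t' else p.

Lemma resolution_exists (S : pzRingType) p (V : 'rV[S]_p -> Prop) :
  noetherian S -> is_submodule V ->
  exists (a : nat -> nat) (A : forall t, 'M[S]_(a t, scons p a t)),
    (forall v, V v <-> exists w, v = w *m A 0%N) /\ forall t, row_exact (A t.+1) (A t).
Proof.
move=> nS hV; have [m0 [B0 hB0]] := noetherian_mx nS hV.
have ker m n (B : 'M[S]_(m, n)) : {q : nat & {C : 'M[S]_(q, m) | row_exact C B}}.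
  have /cid[f fE] : exists f : {linear 'rV[S]_m -> 'rV[S]_n}, f =1 mulmxr B.
    by apply: linear_ex => c v w; rewrite linearP.
  have /cid[q /cid[C hC]] := noetherian_mx nS (submod_ker f).
  by exists q, C => v; rewrite -hC fE.
pose mx := {m : nat & {n : nat & 'M[S]_(m, n)}}.
pose rows (s : mx) := projT1 s.
pose mat (s : mx) : 'M_(rows s, _) := projT2 (projT2 s).
pose next (s : mx) : mx :=
  existT _ (projT1 (ker _ _ (mat s))) (existT _ (rows s) (sval (projT2 (ker _ _ (mat s))))).
pose st t := iter t next (existT _ m0 (existT _ p B0)).
pose a t := rows (st t).
exists a, (fun t => match t return 'M[S]_(a t, scons p a t) with
  0%N => B0 | t'.+1 => sval (projT2 (ker _ _ (mat (st t')))) end).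
split=> // -[|t]; first exact: (svalP (projT2 (ker _ _ (mat (st 0%N))))).
exact: (svalP (projT2 (ker _ _ (mat (st t.+1))))).
Qed.

Section Ext.
Variables (S : pzRingType).
Variables (a : nat -> nat) (A : forall t, 'M[S]_(a t.+1, a t)).

Definition prev_dim t := if t is t'.+1 then a t' else 0%N.

(** The matrix that follows [A t]; past the end of the resolution it has no column. *)
Definition prev_mx t : 'M[S]_(a t, prev_dim t) :=
  match t with 0%N => 0 | t'.+1 => A t' end.

Definition ext_zero t (P : lmodType S) (K : P -> Prop) := ext0 (A t) (prev_mx t) K.

Hypothesis hA : forall t, row_exact (A t.+1) (A t).

Lemma mx_prev_mx t : A t *m prev_mx t = 0.
Proof. by case: t => [|t]; [exact: mulmx0|exact: row_exact_comp]. Qed.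

Lemma ext_zero_ext t (P : lmodType S) (K K' : P -> Prop) :
  (forall x, K x <-> K' x) -> ext_zero t K -> ext_zero t K'.
Proof.
move=> KK' h x Kx; have [|y hy] := h x; first by move=> i; apply/KK'.
by exists y => i; apply/KK'.
Qed.

Lemma ext_zero_rV t m : ext_zero t (fun x : S^o => x = 0) ->
  ext_zero t (fun x : 'rV[S]_m => x = 0).
Proof.
move=> h x Ax.
have ex k : exists y : power S^o (prev_dim t), forall i,
    (((fun i => x i 0 k) : power S^o _) - act (prev_mx t) y) i = 0.
  apply: h => i; have /rowP/(_ k) := Ax i.
  by rewrite mxE summxE => <-; apply: eq_bigr => j _; rewrite mxE.
have [y yE] := choice ex.
exists (fun j => \row_k y k j) => i; apply/rowP => k.
rewrite [RHS]mxE -(yE k i) -[LHS]/((x i - act _ _ i) 0 k) !mxE summxE.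
by congr (_ - _); apply: eq_bigr => j _; rewrite !mxE.
Qed.

Lemma ext_zero_col t :
  (forall u : 'cV[S]_(a t), A t *m u = 0 -> exists w, u = prev_mx t *m w) <->
  ext_zero t (fun x : S^o => x = 0).
Proof.
split=> [h x Ax|h u Au].
  have [|w wE] := h (\col_i x i).
    apply/colP => i; rewrite [RHS]mxE -[RHS](Ax i) mxE.
    by apply: eq_bigr => j _; rewrite mxE.
  exists (fun j => w j 0) => i; apply/eqP; rewrite subr_eq0; apply/eqP.
  by have /colP/(_ i) := wE; rewrite !mxE.
have [|y hy] := h (fun i => u i 0).
  by move=> i; have /colP/(_ i) := Au; rewrite !mxE.
exists (\col_j y j); apply/colP => i.
have /eqP := hy i; rewrite subr_eq0 => /eqP ->; rewrite mxE.
by apply: eq_bigr => j _; rewrite mxE.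
Qed.

(** Ext into an injective module vanishes in positive degrees. *)
Lemma ext_zero_injective t (E : lmodType S) : injective_module E ->
  ext_zero t.+1 (fun x : E => x = 0).
Proof.
move=> hE x Ax; have [|g gE] := injective_exact hE (@hA t) (e := x).
  by apply: dprodP => i; exact: Ax.
by exists g => i; rewrite gE; exact: subrr.
Qed.

(** The augmentation and the differentials of an injective resolution are put in one
    sequence, so that the augmented complex is exact by a single rule. *)
Section Coresolution.
Variables (B : lmodType S) (I : min_inj_res B).

Definition coaug_term p : lmodType S := if p is p'.+1 then I p' else B.
Definition coaug_diff p : {linear coaug_term p -> coaug_term p.+1} :=
  match p with 0%N => mir_aug I | p'.+1 => mir_diff I p' end.

Lemma coaug_exact p y : coaug_diff p.+1 y = 0 <-> exists x, coaug_diff p x = y.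
Proof. by case: p y => [|p] y; [exact: mir_exact0|exact: mir_exact]. Qed.

Lemma coaug_ker0 x : x = 0 <-> coaug_diff 0 x = 0.
Proof. by split=> [->|/(inj_lin0 (@mir_aug_inj _ _ I))] //; exact: linear0. Qed.

Lemma coaug_essential p : essential_image (coaug_diff p).
Proof. by case: p => [|p]; [exact: mir_essential0|exact: mir_essential]. Qed.

(** Shifting down from [Hom(N, I_(p+q))] through the cosyzygies, each realized as
    [X_p] modulo the kernel of the differential out of it. *)
Lemma ext_zero_from_hom q p : ext_zero 0 (fun x : I (p + q)%N => x = 0) ->
  ext_zero q (fun x => coaug_diff p x = 0).
Proof.
elim: q p => [|q ih] p h.
  rewrite addn0 in h => x Ax.
  have [|y hy] := h (tmap (coaug_diff p) x); first by move=> i; rewrite -tmap_act; exact: Ax.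
  exists 0 => i; rewrite act0l in hy; rewrite act0l.
  by have := hy i; rewrite !subr0.
apply: (ext0_down (g := coaug_diff p)) (ih p.+1 _) _ => //.
- exact: coaug_exact.
- exact: mx_prev_mx.
- by rewrite addSnnS.
- by apply: ext_zero_injective; exact: mir_injective.
Qed.

(** [Ext^q(N, B)] is a subquotient of [Hom(N, I_q(B))]. *)
Lemma ext_zero_of_hom_zero q : ext_zero 0 (fun x : I q => x = 0) ->
  ext_zero q (fun x : B => x = 0).
Proof.
move=> h; apply: ext_zero_ext (@ext_zero_from_hom q 0%N h) => x.
by split=> /coaug_ker0.
Qed.

(** Shifting up: the [p]-th cosyzygy inherits the vanishing of Ext into [B] once
    there is no map into the injective terms before it. *)
Lemma ext_zero_cosyzygy p m :
  (forall t, (t <= p + m)%N -> ext_zero t (fun x : B => x = 0)) ->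
  (forall r, (r < p)%N -> ext_zero 0 (fun x : I r => x = 0)) ->
  ext_zero m (fun x => coaug_diff p x = 0).
Proof.
elim: p m => [|p ih] m hB hI.
  by apply: ext_zero_ext (hB m _) => // x; exact: coaug_ker0.
apply: (ext0_up (A := A m.+1) (g := coaug_diff p) (K0 := fun x => coaug_diff p x = 0)) => //.
- exact: row_exact_comp.
- exact: coaug_exact.
- case: m hB => [|m] hB; first exact: hI.
  by apply: ext_zero_injective; exact: mir_injective.
- by apply: ih => [t|r rp]; [rewrite addnS; exact: hB|apply: hI; exact: ltnW].
Qed.
End Coresolution.
End Ext.

(** The matrices [A] resolve the cyclic submodule of [L/K]
    generated by the class of [x]. *)
Definition cyclic_res (S : pzRingType) (L : lmodType S) (a : nat -> nat)
    (A : forall t, 'M[S]_(a t, scons 1 a t)) (K : L -> Prop) (x : L) :=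
  (forall r : 'rV[S]_1, K (r 0 0 *: x) <-> exists w, r = w *m A 0%N) /\
  forall t, row_exact (A t.+1) (A t).

Section Cyclic.
Variables (S : pzRingType) (L : lmodType S) (K : L -> Prop) (hK : is_submodule K).

Lemma cyclic_res_exists x : noetherian S -> exists a A, @cyclic_res S L a A K x.
Proof.
move=> nS; have [|a [A [A0 hA]]] := @resolution_exists S 1 (fun r => K (r 0 0 *: x)) nS.
  split; first by rewrite mxE scale0r; exact: (submod0 hK).
    by move=> r s Kr Ks; rewrite mxE scalerDl; exact: (submodD hK).
  by move=> c r Kr; rewrite mxE -scalerA; exact: (submodZ hK).
by exists a, A; split.
Qed.

Variables (a : nat -> nat) (A : forall t, 'M[S]_(a t, scons 1 a t)) (x : L).
Hypothesis hA : cyclic_res A K x.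

(** A map from the cyclic module is given by an element annihilated by everything
    that annihilates the generator. *)
Lemma cyclic_hom (E : lmodType S) (KE : E -> Prop) : is_submodule KE ->
  ext_zero (a := scons 1 a) A 0 KE <->
  forall e, (forall r, K (r *: x) -> KE (r *: e)) -> KE e.
Proof.
move=> hKE; split=> [h e he|h y Ay].
  have [|y hy] := h (fun _ => e).
    move=> i; rewrite -[act _ _ i]/(act (A 0%N) (fun _ => e : E) i) /act big_ord1.
    apply: he; have := (hA.1 (row i (A 0%N))).2 (ex_intro _ (delta_mx 0 i) (rowE _ _)).
    by rewrite mxE.
  have := hy 0; rewrite act0l subr0; exact.
exists 0 => i; rewrite act0l subr0; rewrite [i]ord1.
apply: h => r; have -> : r = (r%:M : 'rV[S]_1) 0 0 by rewrite mxE.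
move=> /(hA.1 _)[w wE]; have -> : (r%:M : 'rV_1) 0 0 *: y 0 = act (w *m A 0%N) y 0.
  by rewrite -wE /act big_ord1.
rewrite act_mul /act; apply: (submod_sum hKE) => j _; apply: (submodZ hKE); exact: Ay.
Qed.
End Cyclic.

(** * Homomorphisms into minimal injective resolutions *)

(** By essentiality a nonzero map from a cyclic submodule of [T/K] to [I_s] restricts
    to a nonzero map from a smaller cyclic submodule to the [s]-th cosyzygy of [S],
    and dimension shifting makes it a nonzero class in Ext of degree [s]. *)
Lemma hom_zero_of_ext (S : pzRingType) (L : lmodType S) (K T : L -> Prop)
    (I : min_inj_res S^o) (j : nat) :
  (forall x r, T x -> T (r *: x)) ->
  (forall x, T x -> exists a A, @cyclic_res S L a A K x /\
     forall t, (t <= j)%N -> ext_zero (a := scons 1 a) A t (fun y : S^o => y = 0)) ->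
  forall s x (e : I s), (s <= j)%N -> T x -> (forall r, K (r *: x) -> r *: e = 0) -> e = 0.
Proof.
move=> TZ hT; elim/ltn_ind => s ih x e sj Tx he; apply: contrapT => e0.
have [|z [r zr] z0] := coaug_essential (I := I) (p := s) (submod_span1 e).
  by exists e => //; exists 1; rewrite scale1r.
apply: z0.
have [a [A [hA hext]]] := hT _ (TZ x r Tx).
have hker := @ext_zero_cosyzygy _ _ A hA.2 _ I s 0.
have /(cyclic_hom hA (submod_ker (coaug_diff I s))) hom : 
    ext_zero (a := scons 1 a) A 0 (fun x => coaug_diff I s x = 0).
  apply: hker => [t|q qs]; first by rewrite addn0 => ts; apply: hext; exact: leq_trans sj.
  apply/(cyclic_hom hA (submod_zero (I q))) => e' he'.
  by apply: (ih q qs (r *: x) e' _ (TZ x r Tx) he'); exact: leq_trans (ltnW qs) sj.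
apply: hom => q; rewrite scalerA => /he qe.
by rewrite linearZ /= zr scalerA.
Qed.

Section DirectSum.
Variables (S : pzRingType) (X : eqType) (W : X -> lmodType S) (D : lmodType S).
Variables (inj : forall i, {linear W i -> D}) (hD : is_direct_sum inj).

(** Elements of a direct sum have finite support.  The universal property yields this
    in the form that endomorphisms agreeing on finitely many summands agree on [d]:
    such [d] form a submodule, and the quotient by it receives only the zero map. *)
Lemma direct_sum_support (d : D) : exists s : seq X, forall h h' : {linear D -> D},
  (forall i, i \in s -> forall x, h (inj i x) = h' (inj i x)) -> h d = h' d.
Proof.
pose G (d : D) := exists s : seq X, forall h h' : {linear D -> D},
  (forall i, i \in s -> forall x, h (inj i x) = h' (inj i x)) -> h d = h' d.
have hG : is_submodule G.
  split; first by exists [::] => h h' _; rewrite !linear0.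
  - move=> x y [s hs] [t ht]; exists (s ++ t) => h h' st; rewrite !linearD (hs h h') ?(ht h h') //.
      by move=> i it; apply: st; rewrite mem_cat it orbT.
    by move=> i it; apply: st; rewrite mem_cat it.
  - by move=> r x [s hs]; exists s => h h' st; rewrite !linearZ (hs h h').
have [h0 [_ uniq]] := hD (fun i => (\0 : {linear W i -> quot hG})).
suff : proj hG d = 0 by move/proj_eq0.
have -> : proj hG d = h0 d.
  apply: (uniq (proj hG)) => i x; apply/proj_eq0; exists [:: i] => h h'.
  by move/(_ i); rewrite inE eqxx => /(_ isT).
by apply/esym/(uniq \0).
Qed.

(** Read with [J] the annihilator of the generator of a cyclic module [N]: if [N] has
    no nonzero map to the summands, then it has none to the direct sum, because the
    coordinates determine an element of finite support. *)
Lemma direct_sum_zero (J : S -> Prop) :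
  (forall i (e : W i), (forall r, J r -> r *: e = 0) -> e = 0) ->
  forall d : D, (forall r, J r -> r *: d = 0) -> d = 0.
Proof.
move=> hW d hd.
have [in0 [in0_in in0_out]] := dprod_inj W.
have [pr [prE _]] := hD in0.
have [s hs] := direct_sum_support d.
have [c x y|h hE] := @linear_ex S D D (fun d => \sum_(i <- undup s) inj i (pr d i)).
  rewrite scaler_sumr -big_split; apply: eq_bigr => i _.
  rewrite linearP -[X in inj i X]/(c *: pr x i + pr y i).
  exact: (linearP (inj i) c (pr x i) (pr y i)).
have -> : d = h d.
  apply: (hs idfun h) => i si x; rewrite hE (bigD1_seq i) ?mem_undup ?undup_uniq //=.
  rewrite prE in0_in big1 ?addr0 // => k ki.
  by rewrite in0_out ?linear0 // eq_sym.
rewrite hE big1 // => i _.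
have -> : pr d i = 0; last exact: linear0.
apply: hW => r /hd rd.
by rewrite -[LHS]/((r *: pr d) i) -linearZ rd linear0.
Qed.
End DirectSum.

Lemma in_Add_zero (S : pzRingType) (W U : lmodType S) (J : S -> Prop) :
  in_Add W U -> (forall e : W, (forall r, J r -> r *: e = 0) -> e = 0) ->
  forall e : U, (forall r, J r -> r *: e = 0) -> e = 0.
Proof.
move=> [X [D [inj [hD [V [f fbij]]]]]] hW e he.
have hDz := @direct_sum_zero S {classic X} (fun _ => W) D inj hD J (fun _ => hW).
have /(inj_lin0 (bij_inj fbij)) : f (e, 0) = 0.
  apply: hDz => r /he re; rewrite -linearZ -[r *: (e, 0)]/(r *: e, r *: 0) re scaler0.
  exact: linear0.
by move=> /(congr1 fst).
Qed.

(** * Duality between Ext and Tor for torsion submodules *)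

Section Glue.
Variables (S : pzRingType) (M : lmodType S).

Definition glue m n (x : power M m) (y : power M n) : power M (m + n) :=
  fun i => match split i with inl j => x j | inr j => y j end.

Lemma glue_l m n (x : power M m) (y : power M n) j : glue x y (lshift n j) = x j.
Proof. by rewrite /glue -[lshift n j]/(unsplit (inl j)) unsplitK. Qed.
Lemma glue_r m n (x : power M m) (y : power M n) j : glue x y (rshift m j) = y j.
Proof. by rewrite /glue -[rshift m j]/(unsplit (inr j)) unsplitK. Qed.

Lemma act_row_mx p m n (B : 'M[S]_(p, m)) (C : 'M[S]_(p, n)) (x : power M (m + n)) :
  act (row_mx B C) x = act B (fun i => x (lshift n i)) + act C (fun i => x (rshift m i)).
Proof.
apply: dprodP => i; rewrite -[RHS]/(act B _ i + act C _ i) /act big_split_ord.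
by congr (_ + _); apply: eq_bigr => j _; rewrite ?row_mxEl ?row_mxEr.
Qed.

Lemma act_row_glue p m n (B : 'M[S]_(p, m)) (C : 'M[S]_(p, n)) (x : power M m) (y : power M n) :
  act (row_mx B C) (glue x y) = act B x + act C y.
Proof.
rewrite act_row_mx; congr (act B _ + act C _); apply: dprodP => i.
  exact: glue_l.
exact: glue_r.
Qed.

Lemma act_col_mx p q n (B : 'M[S]_(p, n)) (C : 'M[S]_(q, n)) (x : power M n) :
  act (col_mx B C) x = glue (act B x) (act C x).
Proof.
apply: dprodP => i; rewrite -(splitK i); case: (split i) => k /=.
  by rewrite glue_l; apply: eq_bigr => j _; rewrite col_mxEu.
by rewrite glue_r; apply: eq_bigr => j _; rewrite col_mxEd.
Qed.
End Glue.

(** Here [C 1], [C 2], ... resolve [X = coker (C 1)], and [A] resolves the submodule [N]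
    of [X] generated by the rows of [x].  The mapping cone resolves [X/N]; from [C 0]
    will come the functionals on [X] that vanish on [N]. *)
Section Cone.
Variables (S : pzRingType).
Variables (c : nat -> nat) (C : forall t, 'M[S]_(c t.+1, c t)).
Variables (a : nat -> nat) (A : forall t, 'M[S]_(a t.+1, a t)).
Hypothesis hC : forall t, row_exact (C t.+2) (C t.+1).
Hypothesis hA : forall t, row_exact (A t.+1) (A t).
Variable x : 'M[S]_(a 0%N, c 1%N).
Hypothesis hx : forall v : 'rV_(a 0%N),
  (exists w, v *m x = w *m C 1%N) <-> exists w, v = w *m A 0%N.

Definition lift_mx m n q (Y : 'M[S]_(m, n)) (B : 'M[S]_(q, n)) : 'M[S]_(m, q) :=
  xget 0 (fun Z => Z *m B = Y).

Lemma lift_mxP m n q (Y : 'M[S]_(m, n)) (B : 'M[S]_(q, n)) :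
  (forall v : 'rV_m, exists w, v *m Y = w *m B) -> lift_mx Y B *m B = Y.
Proof.
move=> h; have [f hf] := choice h.
apply: (@xgetPex _ 0 (fun Z => Z *m B = Y)); exists (\matrix_i f (delta_mx 0 i)).
by apply/row_matrixP => i; rewrite row_mul rowK -hf -rowE.
Qed.

(** The lift of the inclusion of [N] in [X] to the resolutions. *)
Fixpoint chain_map t : 'M[S]_(a t, c t.+1) :=
  match t with 0%N => x | t'.+1 => lift_mx (A t' *m chain_map t') (C t'.+1) end.

Lemma chain_mapS t : chain_map t.+1 *m C t.+1 = A t *m chain_map t.
Proof.
elim: t => [|t ih]; apply: lift_mxP => v.
  by rewrite mulmxA; apply/hx; exists v.
rewrite mulmxA; apply/hC.
by rewrite -mulmxA ih mulmxA -(mulmxA v) (row_exact_comp (@hA t)) mulmx0 mul0mx.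
Qed.

Definition cone_dim t := (c t.+1 + prev_dim a t)%N.
Definition cone t : 'M[S]_(cone_dim t.+1, cone_dim t) :=
  block_mx (C t.+1) 0 (chain_map t) (- prev_mx A t).

Lemma cone_comp t : cone t.+1 *m cone t = 0.
Proof.
rewrite mulmx_block !mulmx0 !mul0mx !addr0 (row_exact_comp (@hC t)) chain_mapS.
rewrite mulNmx subrr mulNmx mulmxN opprK (mx_prev_mx hA) ?add0r.
by rewrite block_mx0.
Qed.

Lemma cone_exact t : row_exact (cone t.+1) (cone t).
Proof.
move=> v; split=> [|[w ->]]; last by rewrite -mulmxA cone_comp mulmx0.
rewrite -[v]hsubmxK; set u := lsubmx v; set b := rsubmx v.
rewrite mul_row_block mulmx0 add0r mulmxN.
rewrite -[RHS]row_mx0 => /eq_row_mx[uE /eqP]; rewrite oppr_eq0 => /eqP bE.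
have [b' b'E] : exists b', b = b' *m A t.
  move: {v} u b uE bE; case: t => [|t] u b uE bE; last exact/hA.
  apply/hx; exists (- u); apply/eqP; rewrite mulNmx -addr_eq0 addrC; exact/eqP.
have /hC[u' u'E] : (u + b' *m chain_map t.+1) *m C t.+1 = 0.
  by rewrite mulmxDl -mulmxA chain_mapS mulmxA -b'E.
exists (row_mx u' (- b')); rewrite mul_row_block mulmx0 add0r mulNmx mulmxN mulNmx opprK.
by rewrite -u'E addrK -b'E.
Qed.

Lemma op_cone t : op_mx (cone t) =
  col_mx (row_mx (op_mx (C t.+1)) (op_mx (chain_map t))) (row_mx 0 (- op_mx (prev_mx A t))).
Proof. by rewrite -op_mxN -(op_mx0 S); exact: tr_block_mx. Qed.

(** The map [Tor_s(E, N) -> Tor_s(E, X)] is injective, as [Tor_(s+1)(E, X/N) = 0].  It is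
    also zero: as [E] is injective, an element of [Tor_s(E, X)] vanishes when it
    vanishes on the kernel of the dual of [C s.+1].  This kernel is the image of
    the dual of [C s]: for [s > 0] it consists of coboundaries, and for [s = 0] of
    multiples of [C 0], which kill [N]. *)
Lemma tor_zero (E : lmodType S^c) d s (e : power E (a s)) :
  injective_module E -> fd_le E d -> (d <= s)%N ->
  (forall u : 'cV[S]_(c s.+1), C s.+1 *m u = 0 -> exists w, u = C s *m w) ->
  x *m C 0%N = 0 ->
  act (op_mx (prev_mx A s)) e = 0 ->
  exists f : power E (a s.+1), e = act (op_mx (A s)) f.
Proof.
move=> hE fdE ds dual xC Ae.
have [g gE] : exists g : power E (c s.+2),
    act (op_mx (chain_map s)) e = act (op_mx (C s.+1)) g.
  apply: injective_act hE _ => v hv.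
  have [|w wE] := dual (v^T : 'cV[S]_(c s.+1)).
    by apply: op_mx_inj0; rewrite op_mxM {1}/op_mx trmxK.
  have -> : v = op_mx w *m op_mx (C s).
    by rewrite -op_mxM -wE /op_mx trmxK.
  rewrite act_mul -(act_mul (op_mx (C s))) -op_mxM.
  (* s = 0 is where the vanishing of C 0 on N is used *)
  have -> : act (op_mx (chain_map s *m C s)) e = 0; last by rewrite act0r.
  case: (s) e Ae => [|s'] e' Ae'; first by rewrite xC op_mx0 act0l.
  by rewrite chain_mapS op_mxM act_mul Ae' act0r.
have [|f fE] := @flat_dim_tor S cone_dim cone cone_exact E d s (glue (- g) e) fdE ds.
  rewrite op_cone act_col_mx !act_row_glue act0l add0r actNl Ae oppr0 actN gE addNr.
  by apply: dprodP => i; rewrite -(splitK i); case: (split i) => k; rewrite ?glue_l ?glue_r.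
pose f2 : power E (a s.+1) := fun i => f (rshift (c s.+3) i).
exists (- f2); apply: dprodP => k.
rewrite -[LHS](glue_r (- g) e k) fE op_cone act_col_mx glue_r act_row_mx act0l add0r.
by rewrite actNl actN; congr (- act _ _ _).
Qed.
End Cone.

(** A class [u] in [Ext^s(N, R)] generates a right module [Y].  By the hypothesis and
    injectivity of [I_t] there is no nonzero map [Y -> I_t] for [t <= s], so
    [Ext^t(Y, R) = 0] for these [t].  By induction the dual of the resolution of [N] is
    exact below degree [s], and shifting along it gives [Hom(Y, C) = 0] for the cokernel
    [C] of its differential into degree [s]; but [Y] is contained in [C]. *)
Lemma ext_zero_of_tor_zero (S : pzRingType) (I : min_inj_res (S^c)^o)
    (a : nat -> nat) (A : forall t, 'M[S]_(a t.+1, a t)) j :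
  noetherian S^c -> (forall t, row_exact (A t.+1) (A t)) ->
  (forall s t (e : power (I t) (a s)), (s <= j)%N -> (t <= s)%N ->
     act (op_mx (prev_mx A s)) e = 0 ->
     exists f, e = act (op_mx (A s)) f) ->
  forall s, (s <= j)%N -> ext_zero A s (fun y : S^o => y = 0).
Proof.
move=> nS hA tor s sj; apply/ext_zero_col.
elim/ltn_ind: s sj => s ih sj u Au.
pose R := S^c.
pose pT r := op_mx (prev_mx A r).
pose K r (v : 'rV[R]_(a r)) := exists w, v = w *m pT r.
have hK r : is_submodule (K r) := submod_row_space (pT r).
pose u' : 'rV[R]_(a s) := op_mx u.
have [z [Z hZ]] := cyclic_res_exists (hK s) u' nS.
(* Hom(Y, I_t) = 0: extend the map to the free module containing u *)
have hom t : (t <= s)%N -> ext_zero (a := scons 1 z) Z 0 (fun y : I t => y = 0).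
  move=> ts; apply/(cyclic_hom hZ (submod_zero (I t))) => e he.
  have [c r r'|f fE] := @linear_ex R R^o (quot (hK s)) (fun r => proj (hK s) ((r : R) *: u')).
    by rewrite -linearP scalerDl -scalerA.
  have [c r r'|g gE] := @linear_ex R R^o (I t) (fun r => (r : R) *: e).
    by rewrite scalerDl -scalerA.
  have [r|h hE] := inj_factor (f := f) (g := g) (@mir_injective _ _ I t).
    by rewrite fE gE => /proj_eq0; exact: he.
  pose e' : power (I t) (a s) := fun i => h (proj (hK s) (delta_mx 0 i)).
  have hv v : h (proj (hK s) v) = act v e' 0.
    rewrite [v in LHS]matrix_sum_delta big_ord1 !linear_sum.
    by apply: eq_bigr => i _; rewrite !linearZ.
  have [|f' f'E] := tor s t e' sj ts.
    apply: dprodP => l; rewrite -act_row -hv.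
    have -> : proj (hK s) (row l (op_mx (prev_mx A s))) = 0; last exact: linear0.
    by apply/proj_eq0; exists (delta_mx 0 l); rewrite /pT /op_mx -rowE.
  have eE : e = act u' e' 0.
    by rewrite -hv -[u' in RHS]scale1r -fE hE gE scale1r.
  by rewrite eE f'E -act_mul -op_mxM Au op_mx0 act0l.
(* Ext^t(Y, -) of the cokernels in the dual complex, for t + r <= s *)
have key r t : (r <= s)%N -> (t + r <= s)%N -> ext_zero (a := scons 1 z) Z t (K r).
  elim: r t => [|r ihr] t rs tr.
    rewrite addn0 in tr.
    apply: ext_zero_ext (ext_zero_rV (ext_zero_of_hom_zero hZ.2 (hom t tr))) => v.
    split=> [->|[w ->]]; first by exists 0; rewrite mul0mx.
    by rewrite [w]thinmx0 mul0mx.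
  have [c v w|g gE] := @linear_ex R 'rV[R]_(a r) 'rV[R]_(a r.+1) (mulmxr (op_mx (A r))).
    by rewrite linearP.
  apply: (ext0_up (A := Z t.+1) (g := g) (K0 := K r)).
  - exact: (row_exact_comp (hZ.2 t)).
  - move=> v; rewrite gE /=; split=> [[w ->]|vA].
      by rewrite -mulmxA -op_mxM mx_prev_mx // op_mx0 mulmx0.
    have [|w wE] := ih r rs (leq_trans (ltnW rs) sj) (v^T : 'cV[S]_(a r)).
      by apply: op_mx_inj0; rewrite op_mxM {1}/op_mx trmxK.
    by exists (op_mx w); rewrite -op_mxM -wE /op_mx trmxK.
  - by move=> v; split=> [[w ->]|[w <-]]; exists w; rewrite gE.
  - have tr' : (t <= s)%N by apply: leq_trans tr; exact: leq_addr.
    exact: ext_zero_rV (ext_zero_of_hom_zero hZ.2 (hom t tr')).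
  - by apply: ihr; [exact: ltnW|rewrite addSnnS].
have /(cyclic_hom hZ (hK s)) h := key s 0%N (leqnn s) (leqnn s).
have [//|w wE] := h u'.
by exists w^T; apply: trmx_inj; rewrite -[LHS]/u' wE -[RHS]/(op_mx (_ *m _)) op_mxM /op_mx trmxK.
Qed.

(** * Left approximations *)

(** What remains of the exact sequence [M -> P^0 -> ... -> P^(j-1) -> M_j -> 0], where
    [M_j] is the quotient by [K]: Ext into [M_j] is governed by Ext into [M] in degree
    [j] higher, for modules with vanishing Ext into the ring. *)
Definition linked (S : pzRingType) (M : lmodType S) (j : nat) p (K : 'rV[S]_p -> Prop) :=
  forall (a : nat -> nat) (A : forall t, 'M[S]_(a t.+1, a t)) t,
    (forall t, row_exact (A t.+1) (A t)) ->
    (forall s, (s <= t + j)%N -> ext_zero A s (fun y : S^o => y = 0)) ->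
    ext_zero A (t + j)%N (fun y : M => y = 0) -> ext_zero A t K.

(** The matrix [C 0] is the approximation of [coker (C 1) = M_j]; what is claimed is
    that it is injective there.  The hypothesis on columns expresses both the
    approximation property of [C 0] and the vanishing of [Ext^s(M_j, R)]. *)
Lemma approximation_exact (S : pzRingType) (M : lmodType S) (j : nat)
    (I : min_inj_res (S^c)^o) (IM : min_inj_res M) (IS : min_inj_res S^o)
    (c : nat -> nat) (C : forall t, 'M[S]_(c t.+1, c t)) :
  noetherian S -> noetherian S^c ->
  (forall t, (t <= j)%N -> fd_le (I t) t) ->
  (forall l, (l <= j)%N -> exists (W : lmodType S)
     (inj : forall q : 'I_l.+1, {linear IS q -> W}), is_direct_sum inj /\ in_Add W (IM l)) ->
  (forall t, row_exact (C t.+2) (C t.+1)) -> C 1%N *m C 0%N = 0 ->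
  (forall s (u : 'cV[S]_(c s.+1)), (s <= j)%N -> C s.+1 *m u = 0 -> exists w, u = C s *m w) ->
  linked M j (fun v : 'rV_(c 1%N) => exists w, v = w *m C 1%N) ->
  row_exact (C 1%N) (C 0%N).
Proof.
move=> nS nSc fdI hAdd hC CC dual link.
pose K (v : 'rV[S]_(c 1%N)) := exists w, v = w *m C 1%N.
have hK : is_submodule K := submod_row_space (C 1%N).
pose T (v : 'rV[S]_(c 1%N)) := v *m C 0%N = 0.
have TZ v r : T v -> T (r *: v) by rewrite /T -scalemxAl => ->; rewrite scaler0.
have hT v : T v -> exists a A, @cyclic_res S _ a A K v /\
    forall t, (t <= j)%N -> ext_zero (a := scons 1 a) A t (fun y : S^o => y = 0).
  move=> Tv; have [a [A hA]] := cyclic_res_exists hK v nS.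
  exists a, A; split=> //; apply: (ext_zero_of_tor_zero (I := I) nSc hA.2) => s t e sj ts.
  apply: (@tor_zero S c C (scons 1 a) A hC hA.2 v _ (I t) t s e) => //.
  - move=> r; apply: iff_trans (hA.1 r); rewrite /K.
    by rewrite [r in r *m v]mx11_scalar mul_scalar_mx.
  - exact: mir_injective.
  - by apply: fdI; exact: leq_trans sj.
  - by move=> u; exact: dual.
have homR := hom_zero_of_ext (I := IS) TZ hT.
move=> x; split=> [Tx|[w ->]]; last by rewrite -mulmxA CC mulmx0.
have [a [A [hA hext]]] := hT x Tx.
have homM l : (l <= j)%N -> ext_zero (a := scons 1 a) A 0 (fun y : IM l => y = 0).
  move=> lj; apply/(cyclic_hom hA (submod_zero (IM l))).
  have [W [inj [hW Wadd]]] := hAdd l lj.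
  apply: (in_Add_zero Wadd); apply: (direct_sum_zero hW) => q e.
  apply: homR Tx; by apply: leq_trans lj; rewrite -ltnS; exact: ltn_ord.
have extM : ext_zero (a := scons 1 a) A j (fun y : M => y = 0).
  by apply: (ext_zero_of_hom_zero hA.2); exact: homM.
have /(cyclic_hom hA hK) h := link (scons 1 a) A 0%N hA.2 hext extM.
exact: h.
Qed.

Lemma rV_fingen (S : pzRingType) b : fingen 'rV[S]_b.
Proof.
exists b, (fun j => delta_mx 0 j) => v; exists (v 0).
by rewrite {1}[v]matrix_sum_delta big_ord1.
Qed.

Lemma rV_projective (S : pzRingType) b : projective 'rV[S]_b.
Proof.
move=> A B p g ps; have [s sE] := choice ps.
have [h hE] := lin_act ((fun j => s (g (delta_mx 0 j))) : power A b).
exists h => v; rewrite hE linear_sum [v in RHS]matrix_sum_delta big_ord1 linear_sum.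
by apply: eq_bigr => j _; rewrite !linearZ /= sE.
Qed.

(** The columns of [D] generate the functionals on the cokernel of [B], so that [D] is
    a left approximation of this cokernel. *)
Lemma right_kernel (S : pzRingType) p q (B : 'M[S]_(p, q)) : noetherian S^c ->
  exists b (D : 'M[S]_(q, b)), B *m D = 0 /\
    forall u : 'cV_q, B *m u = 0 -> exists w, u = D *m w.
Proof.
move=> nSc.
have [c v w|f fE] := @linear_ex S^c 'rV[S^c]_q 'rV[S^c]_p (mulmxr (op_mx B)).
  by rewrite linearP.
have [b [E hE]] := noetherian_mx nSc (submod_ker f).
exists b, (E^T : 'M[S]_(q, b)); split.
  have EB : E *m op_mx B = 0.
    apply/row_matrixP => i; rewrite row_mul row0 -[LHS]/(mulmxr (op_mx B) _) -fE.
    by apply/hE; exists (delta_mx 0 i); rewrite -rowE.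
  have TE : op_mx (E^T : 'M[S]_(q, b)) = E by exact: trmxK.
  by apply: op_mx_inj0; rewrite op_mxM TE.
move=> u Bu; have /hE[w wE] : f (op_mx u) = 0 by rewrite fE /= -op_mxM Bu op_mx0.
exists w^T; apply: trmx_inj.
by rewrite -[LHS]/(op_mx u) wE -[RHS]/(op_mx (_ *m _)) op_mxM /op_mx !trmxK.
Qed.

(** The matrices [C] are the free resolution of [M] spliced with the [j] approximations
    found so far; each step puts the next approximation [D] in front. *)
Lemma syzygy_approximation (S : pzRingType) (M : lmodType S) (i : nat)
    (I : min_inj_res (S^c)^o) (IM : min_inj_res M) (IS : min_inj_res S^o) :
  noetherian S -> noetherian S^c ->
  (forall t, (t < i)%N -> fd_le (I t) t) ->
  (forall l, (l < i)%N -> exists (W : lmodType S)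
     (inj : forall q : 'I_l.+1, {linear IS q -> W}), is_direct_sum inj /\ in_Add W (IM l)) ->
  forall q j (c : nat -> nat) (C : forall t, 'M[S]_(c t.+1, c t)), (j + q = i)%N ->
  (forall t, row_exact (C t.+1) (C t)) ->
  (forall s (u : 'cV[S]_(c s.+1)), (s < j)%N -> C s.+1 *m u = 0 -> exists w, u = C s *m w) ->
  linked M j (fun v : 'rV_(c 0%N) => exists w, v = w *m C 0%N) ->
  syzygy q (quot (submod_row_space (C 0%N))).
Proof.
move=> nS nSc fdI hAdd; elim=> [//|q ih] j c C jq hC dual link.
have ji : (j < i)%N by rewrite -jq addnS ltnS leq_addr.
have [b [D [CD Dker]]] := right_kernel (C 0%N) nSc.
pose c' := scons b c.
pose C' t : 'M[S]_(c' t.+1, c' t) := match t with 0%N => D | t'.+1 => C t' end.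
have dual' s (u : 'cV[S]_(c' s.+1)) : (s < j.+1)%N -> C' s.+1 *m u = 0 -> exists w, u = C' s *m w.
  by case: s u => [|s] u sj; [exact: Dker|exact: dual].
have exD : row_exact (C 0%N) D.
  apply: (@approximation_exact S M j I IM IS c' C') => //.
  - by move=> t tj; apply: fdI; exact: leq_ltn_trans ji.
  - by move=> l lj; apply: hAdd; exact: leq_ltn_trans ji.
have [r v w|g gE] := @linear_ex S 'rV[S]_(c 0%N) 'rV[S]_b (mulmxr D); first by rewrite linearP.
have ps := @proj_surj _ _ _ (submod_row_space (C 0%N)).
have kD x : proj (submod_row_space (C 0%N)) x = 0 <-> g x = 0.
  by rewrite proj_eq0 gE; split=> /exD.
have [f fE] := surj_factor ps (fun x => (kD x).1).
exists 'rV[S]_b, (quot (submod_row_space D)), f, (proj _); split.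
- exact: rV_fingen.
- exact: rV_projective.
- split; last exact: proj_surj.
    by apply: lin_inj => y; have [x <-] := ps y; rewrite fE => /kD.
  apply: proj_exact => y; split=> [[w ->]|[x <-]].
    by exists (proj _ w); rewrite fE gE.
  by have [w <-] := ps x; exists w; rewrite fE gE.
apply: (ih j.+1 c' C') => //.
- by rewrite addSnnS.
- by case=> [|t] //; exact: hC.
move=> a A t hA hext hM.
apply: (ext0_up (A := A t.+1) (g := g) (K0 := fun v => exists w, v = w *m C 0%N)).
- exact: row_exact_comp.
- by move=> v; rewrite gE; split=> /exD.
- by move=> v; split=> [[w ->]|[w <-]]; exists w; rewrite gE.
- by apply: ext_zero_rV; apply: hext; exact: leq_addr.
- apply: (link a A t.+1 hA); last by rewrite addSnnS.
  by move=> s; rewrite addSnnS; exact: hext.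
Qed.

Lemma R_class_syzygy (S : pzRingType) (n i : nat) (M : lmodType S) :
  noetherian S -> noetherian S^c -> n_Gorenstein n S -> (i.+1 <= n)%N ->
  R_class i.+1 M -> syzygy i.+1 M.
Proof.
move=> nS nSc [I fdI] ni [[u [v vE]] [IM [IS hAdd]]].
have [p pE] := lin_act (v : power M u).
have ps : surj p by move=> x; have [d ->] := vE x; exists (\row_j d j);
  rewrite pE; apply: eq_bigr => j _; rewrite mxE.
have [a [A [A0 hA]]] := resolution_exists nS (submod_ker p).
have hM : syzygy i.+1 (quot (submod_row_space (A 0%N))).
  apply: (@syzygy_approximation S M i.+1 I IM IS nS nSc _ hAdd i.+1 0%N (scons u a) A) => //.
    by move=> t ti; apply: fdI; exact: leq_trans ni.
  move=> a' A' t _ _; rewrite addn0 => hext x Kx.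
  have [|y hy] := hext (tmap p x).
    by move=> k; rewrite -tmap_act; apply/A0; exact: Kx.
  have [y' y'E] := choice (fun k => ps (y k)).
  exists y' => k; apply/A0; rewrite -[LHS]/(tmap p (x - act _ y') k) tmapB tmap_act.
  have -> : tmap p (y' : power 'rV_u _) = y by apply: dprodP.
  exact: hy.
have qs := @proj_surj _ _ _ (submod_row_space (A 0%N)).
have pA x : p x = 0 -> proj (submod_row_space (A 0%N)) x = 0.
  by move=> /A0 h; apply/proj_eq0.
have [h hE] := surj_factor ps pA.
have hi : injective h.
  apply: lin_inj => y; have [x <-] := ps y.
  by rewrite hE => /proj_eq0/A0.
have hs : surj h by move=> y; have [x <-] := qs y; exists (p x); rewrite hE.
have [P [N [f [g [fP pP [fi fex gs] hN]]]]] := hM.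
exists P, N, (f \o h), g; split=> //; split=> // [x y /fi/hi //|y].
apply: iff_trans (fex y) _; split=> [[x <-]|[x <-]]; last by exists (h x).
by have [z <-] := hs x; exists z.
Qed.

Theorem theorem2p6 (n : nat) (hn : (1 <= n)%N)
    (k : comNzRingType) (R : algType k) (hR : artin_algebra R)
    (hG : n_Gorenstein n R) :
  forall i : nat, (1 <= i <= n)%N ->
  forall M : lmodType R, R_class i M <-> Omega_class i M.
Proof.
have [nR nRc] := artin_noetherian hR.
move=> [//|i] /andP[_ ni] M; split=> [hM|hM].
  by apply: syzygy_Omega; [case: hM|exact: R_class_syzygy nR nRc hG ni hM].
by apply: syzygy_R_class; [case: hM|exact: Omega_syzygy].
Qed.
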